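(* Let $G$ be a group given by finitely or infinitely many generators $a_1,a_2,a_3,\dots$ and one defining relation $R=1$, where $R$ is a word in the $a_i$. Let $a_{i_1},a_{i_2},a_{i_3},\dots$ be an arbitrary, possibly empty, subset of the generators. Then the extended identity problem is solvable in $G$ for this subset: there is a procedure which, given an arbitrary word $W$ in the $a_i$, decides in a finite number of steps whether or not, as a consequence of the relation $R=1$, $W$ can be transformed into a word $\overline{W}$ consisting only of the generators $a_{i_1},a_{i_2},\dots$ (and their inverses), and which, if $W$ is equal in $G$ to at least one such word, actually produces at least one such $\overline{W}$.
   Context: A word in the generators is a finite product of the $a_i$ and their inverses. If the subset of generators is empty, then the only word $\overline{W}$ is the empty word, so the extended identity problem for the empty subset is the identity (word) problem of $G$, i.e. the problem of deciding whether a given word represents the identity of $G$.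
   Formalization: The procedure may consult membership in the given subset of generators: for an undecidable subset of infinitely many generators no absolute procedure exists (e.g. R = a_1). For decidable subsets, in particular finite or empty ones, it is an ordinary algorithm. *)

(* Defs.v *)
From mathcomp Require Import all_boot.
From Stdlib Require Import Relation_Operators.

Set Implicit Arguments.
Unset Strict Implicit.
Unset Printing Implicit Defensive.

(* The total functions recursive in the oracle A, of all arities: the least
   class containing the initial functions and the characteristic function of A
   and closed under composition, primitive recursion and minimization of
   regular functions.  With A := pred0 (or any recursive A, by
   [recursive_in_trans]) these are exactly the total recursive functions. *)
Inductive recursive_in (A : pred nat) :
    forall k : nat, (k.-tuple nat -> nat) -> Prop :=
| rec_zero k : @recursive_in A k (fun _ => 0)
| rec_succ : @recursive_in A 1 (fun v => (thead v).+1)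
| rec_proj k (i : 'I_k) : recursive_in A (fun v => tnth v i)
| rec_oracle : @recursive_in A 1 (fun v => nat_of_bool (A (thead v)))
| rec_comp k m (g : m.-tuple nat -> nat) (h : 'I_m -> k.-tuple nat -> nat)
    (f : k.-tuple nat -> nat) :
    recursive_in A g -> (forall i, recursive_in A (h i)) ->
    (forall v, f v = g [tuple h i v | i < m]) ->
    recursive_in A f
| rec_prim k (g : k.-tuple nat -> nat) (h : k.+2.-tuple nat -> nat)
    (f : k.+1.-tuple nat -> nat) :
    recursive_in A g -> recursive_in A h ->
    (forall v : k.-tuple nat, f [tuple of 0 :: v] = g v) ->
    (forall n (v : k.-tuple nat), f [tuple of n.+1 :: v]
                 = h [tuple of [:: n, f [tuple of n :: v] & v]]) ->
    recursive_in A f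
| rec_mu k (g : k.+1.-tuple nat -> nat) (f : k.-tuple nat -> nat) :
    recursive_in A g ->
    (forall v : k.-tuple nat, g [tuple of f v :: v] = 0) ->
    (forall (v : k.-tuple nat) n, n < f v -> g [tuple of n :: v] <> 0) ->
    recursive_in A f.

Lemma recursive_in_trans (A B : pred nat) k (f : k.-tuple nat -> nat) :
  @recursive_in B 1 (fun v => nat_of_bool (A (thead v))) ->
  recursive_in A f -> recursive_in B f.
Proof.
move=> BA; elim=> {k f}.
- exact: rec_zero.
- exact: rec_succ.
- exact: rec_proj.
- exact: BA.
- by move=> k m g h f _ Bg _ Bh; apply: rec_comp.
- by move=> k g h f _ Bg _ Bh; apply: rec_prim.
- by move=> k g f _ Bg; apply: rec_mu.
Qed.

(* The generators: n of them for [Some n], infinitely many for [None]. *)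
Definition gen (N : option nat) : countType :=
  if N is Some n then 'I_n else nat.

(* The letter (a, false) is the generator a, and (a, true) is its inverse. *)
Definition word (T : Type) : Type := seq (T * bool).

(* One elementary transformation: inserting somewhere in a word either a pair
   of mutually inverse letters or the relator R. *)
Inductive insertion (T : Type) (R : word T) : word T -> word T -> Prop :=
| insert_pair u v a e :
    insertion R (u ++ v) (u ++ (a, e) :: (a, ~~ e) :: v)
| insert_relator u v : insertion R (u ++ v) (u ++ R ++ v).

(* Equality in the group < T | R = 1 > of the elements represented by two
   words. *)
Definition eq_mod (T : Type) (R : word T) : word T -> word T -> Prop :=
  clos_refl_sym_trans (word T) (insertion R).

Definition word_in (T : Type) (S : pred T) (W : word T) : bool :=
  all (fun l => S l.1) W.

(* Goedel numbering: a_i is numbered 2i, its inverse 2i + 1; here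
   [pickle a = i] for a : gen N of index i. *)
Definition code_word (T : countType) (W : word T) : nat :=
  CodeSeq.code [seq (pickle l.1).*2 + l.2 | l : T * bool <- W].

Definition code_answer (T : countType) (V : option (word T)) : nat :=
  if V is Some V' then (code_word V').+1 else 0.

Definition gen_oracle (T : countType) (S : pred T) : pred nat :=
  fun n => if unpickle n is Some a then S a else false.

(* F is computed by an algorithm that may ask whether a generator is in S.
   The subset S is arbitrary, and the set S itself reduces to the extended
   identity problem for S (almost everywhere, a generator lies in the subgroup
   generated by S only if it is in S), so this access to S cannot be dispensed
   with when S is not recursive; it is redundant when S is recursive, and in
   particular when S is finite. *)
Definition computable_from (T : countType) (S : pred T)
    (F : word T -> option (word T)) : Prop :=
  exists f : nat -> nat,
    @recursive_in (gen_oracle S) 1 (fun v => f (thead v)) /\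
    forall W : word T, f (code_word W) = code_answer (F W).

(* Correctness of the answer V for the input W. *)
Definition extended_identity_answer (T : Type) (R : word T) (S : pred T)
    (W : word T) (V : option (word T)) : Prop :=
  match V with
  | Some V' => word_in S V' /\ eq_mod R W V'
  | None => forall V' : word T, word_in S V' -> ~ eq_mod R W V'
  end.

Definition extended_identity_problem_solvable (T : countType) (R : word T)
    (S : pred T) : Prop :=
  exists F : word T -> option (word T),
    computable_from S F /\
    forall W : word T, extended_identity_answer R S W (F W).

(* Main.v *)
From Stdlib Require Import Setoid Morphisms Relation_Operators.
Require Import Defs.
From mathcomp Require Import all_boot all_order all_algebra.
From mathcomp Require Import boolp zify.
Import GRing.Theory Num.Theory Order.TTheory.

Set Implicit Arguments.
Unset Strict Implicit.
Unset Printing Implicit Defensive.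

(** The proof follows Magnus, with computability reduced to enumerability.  The
    statements W lies in the subgroup generated by S and W does not lie in it
    are both recursively enumerable with oracle S, so that one unbounded search
    decides which of them holds and finds the word in the first case
    ([comp_decide]).  The first statement is enumerable in every group with
    enumerable relators ([re_eqv]).  The second, [co_enumerable], is proved
    together with the Freiheitssatz, [freiheit], by induction on the length of a
    cyclically reduced relator r ([magnus]).

    Let u be a letter of r outside S, and let r contain another letter.  There
    are integer weights of the letters, nonzero on at most two of them, that
    give r the total weight 0 and some letter b of r a weight alpha > 0
    ([two_letters]).  Adjoin an alpha-th root x of b to the group; this is
    an embedding ([root_inj]).  A letter c other than b becomes the product of
    some c_0 and the power of x with exponent w c, and conjugation by the powers
    of x turns c_0 into letters c_i.  The relator then is a conjugate of a word
    r0 in the letters c_i, its lift to an infinite cyclic cover ([lift_word]).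
    All occurrences of b are gone, so r0 is shorter than r and the induction
    hypothesis applies to the group K with the single relator r0.  Let v be
    another letter of r and let v_m and v_M be the lifts of v in r0 with extreme
    indices.  By the Freiheitssatz for r0, the v_i with m <= i < M and the v_i
    with m < i <= M, each together with all lifts of the other letters, freely
    generate subgroups of K.  So the shift of indices is an isomorphism between
    them, which defines an HNN extension P of K with stable letter x.

    The given group maps to P, and P maps back to the group with the root x
    ([sigma_embed]).  Through these maps, membership in the subgroup generated
    by S becomes membership in a subgroup of K generated by letters
    ([mem_sub_strip], [mem_sub_level0]).  An element of P lies outside such a
    subgroup exactly if it is an element of K outside of it, which is enumerable by
    induction, or if it is equal to a word with stable letters and without
    pinches ([not_mem_base], after Britton).  The absence of pinches means
    nonmembership in the two associated subgroups and is enumerable by induction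
    as well ([re_not_mem_base]).  The Freiheitssatz for r follows because a
    trivial word that misses a letter of r lifts to a trivial word that misses a
    letter of r0, hence is freely trivial ([step_free_special],
    [step_free_level0]).

    Two cases remain.  A group whose relator is a power of one letter is an HNN
    extension of a cyclic group with trivial associated subgroups
    ([re_one_letter]).  If S contains all letters of r, then erasing the other
    letters is a retraction, and membership reduces to equality ([retract_mem]). *)

(** * Recursive functions of one number *)

Section Unary.
Variable A : pred nat.

Lemma recursive_ext k (f g : k.-tuple nat -> nat) :
  recursive_in A g -> f =1 g -> recursive_in A f.
Proof.
move=> Ag fg; apply: (rec_comp (h := fun i v => tnth v i) Ag).
  by move=> i; apply: rec_proj.
move=> v; rewrite fg; congr g.
by apply: eq_from_tnth => i; rewrite tnth_mktuple.
Qed.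

Definition rec1 (f : nat -> nat) :=
  @recursive_in A 1 (fun v => f (thead v)).

Definition rec2 (f : nat -> nat -> nat) :=
  @recursive_in A 2 (fun v => f (tnth v ord0) (tnth v (lift ord0 ord0))).

Lemma rec1_comp f k (g : k.-tuple nat -> nat) :
  rec1 f -> recursive_in A g -> recursive_in A (fun v => f (g v)).
Proof.
move=> Af Ag; apply: (rec_comp (h := fun=> g) Af) => // v.
by rewrite /thead tnth_mktuple.
Qed.

Lemma rec2_comp f k (g h : k.-tuple nat -> nat) :
  rec2 f -> recursive_in A g -> recursive_in A h ->
  recursive_in A (fun v => f (g v) (h v)).
Proof.
move=> Af Ag Ah.
apply: (rec_comp (h := fun i => if i == ord0 then g else h) Af) => // [i|v].
  by case: ifP.
by rewrite !tnth_mktuple.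
Qed.

Lemma rec1_id : rec1 id.
Proof. exact: rec_proj. Qed.

Lemma rec1_succ : rec1 succn.
Proof. exact: rec_succ. Qed.

Lemma recursive_cst k c : @recursive_in A k (fun=> c).
Proof.
by elim: c => [|c IHc]; [apply: rec_zero | apply: rec1_comp rec1_succ IHc].
Qed.

Lemma rec1_cst c : rec1 (fun=> c).
Proof. exact: recursive_cst. Qed.

Lemma rec_primn (g : nat) (h : nat -> nat -> nat) (f : nat -> nat) :
  rec2 h -> f 0 = g -> (forall n, f n.+1 = h n (f n)) -> rec1 f.
Proof.
move=> Ah f0 fS.
apply: (@rec_prim A 0 (fun=> g) (fun v => h (tnth v ord0) (tnth v (lift ord0 ord0)))).
- exact: recursive_cst.
- exact: Ah.
- by move=> v; rewrite theadE.
- by move=> n v; rewrite !theadE fS.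
Qed.

Lemma rec_prim1 (g : nat -> nat) (h : nat -> nat -> nat) (f : nat -> nat -> nat) :
  rec1 g -> rec2 h -> (forall a, f 0 a = g a) ->
  (forall n a, f n.+1 a = h (f n a) a) -> rec2 f.
Proof.
move=> Ag Ah f0 fS.
apply: (@rec_prim A 1 (fun v => g (thead v))
  (fun v => h (tnth v (lift ord0 ord0)) (tnth v (lift ord0 (lift ord0 ord0))))).
- exact: Ag.
- exact: rec2_comp Ah (rec_proj A (lift ord0 ord0))
    (rec_proj A (lift ord0 (lift ord0 ord0))).
- by move=> v; rewrite f0 /thead !(tnth_nth 0).
- by move=> n v; rewrite !(tnth_nth 0) /= fS.
Qed.

Lemma rec2_iter h : rec1 h -> rec2 (fun n a => iter n h a).
Proof.
move=> Ah; apply: (rec_prim1 (g := id) (h := fun x _ => h x)) => //.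
  exact: rec1_id.
by apply: rec1_comp Ah _; apply: rec_proj.
Qed.

Lemma rec2_add : rec2 addn.
Proof.
apply: recursive_ext (rec2_iter rec1_succ) _ => v.
by elim: (tnth v ord0) => //= n <-.
Qed.

Lemma rec1_pred : rec1 predn.
Proof. by apply: (rec_primn (g := 0) (h := fun n _ => n)) => //; apply: rec_proj. Qed.

Lemma rec2_sub : rec2 (fun a b => b - a).
Proof.
apply: recursive_ext (rec2_iter rec1_pred) _ => v.
by elim: (tnth v ord0) => [|n IHn]; rewrite ?subn0 // subnS IHn.
Qed.

Lemma rec1_double : rec1 double.
Proof.
apply: recursive_ext (rec2_comp rec2_add rec1_id rec1_id) _ => v.
by rewrite addnn.
Qed.

Lemma rec1_not : rec1 (subn 1).
Proof. exact: rec2_comp rec2_sub rec1_id (recursive_cst _ 1). Qed.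

Lemma rec1_odd : rec1 (fun n => odd n).
Proof.
apply: (rec_primn (g := 0) (h := fun _ x => 1 - x)) => //.
  by apply: rec1_comp rec1_not _; apply: rec_proj.
by move=> n /=; case: odd.
Qed.

Lemma rec1_half : rec1 half.
Proof.
apply: (rec_primn (g := 0) (h := fun n x => odd n + x)) => //.
  by apply: rec2_comp rec2_add (rec1_comp rec1_odd _) _; apply: rec_proj.
by move=> n; rewrite -uphalfE uphalf_half.
Qed.

(** The pairing that underlies [CodeSeq.code]: with it, coded sequences are
    built and taken apart by recursive functions ([code_cons]). *)
Definition cpair a b := (2 ^ a * b.*2.+1).-1.
Definition cfst n := logn 2 n.+1.
Definition csnd n := (n.+1 %/ 2 ^ cfst n)./2.

Lemma cpairS a b : (cpair a b).+1 = 2 ^ a * b.*2.+1.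
Proof. by rewrite prednK // muln_gt0 expn_gt0. Qed.

Lemma cpairK1 a b : cfst (cpair a b) = a.
Proof.
rewrite /cfst cpairS lognM ?expn_gt0 // pfactorK // [logn _ b.*2.+1]lognE.
by rewrite dvdn2 /= odd_double addn0.
Qed.

Lemma cpairK2 a b : csnd (cpair a b) = b.
Proof. by rewrite /csnd cpairK1 cpairS mulKn ?expn_gt0 // -uphalfE uphalf_double. Qed.

Lemma cfst_csndK n : cpair (cfst n) (csnd n) = n.
Proof.
apply: succn_inj; rewrite cpairS /csnd; set m := _ %/ _.
have nE : n.+1 = 2 ^ cfst n * m.
  by rewrite mulnC divnK // pfactor_dvdnn.
have m_gt0 : 0 < m by case: (m) nE => //; rewrite muln0.
suff odd_m : odd m.
  by rewrite nE -[in RHS](odd_double_half m) odd_m.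
apply/negPn/negP => ev_m.
have : 2 ^ (cfst n).+1 %| n.+1.
  by rewrite nE expnSr dvdn_pmul2l ?expn_gt0 // dvdn2.
by rewrite pfactor_dvdn // ltnn.
Qed.

Lemma code_cons n s : CodeSeq.code (n :: s) = (cpair n (CodeSeq.code s)).+1.
Proof. by rewrite cpairS. Qed.

Lemma rec2_cpair : rec2 cpair.
Proof.
apply: recursive_ext
  (rec1_comp rec1_pred (rec2_comp (rec2_iter rec1_double) (rec_proj A ord0)
     (rec1_comp rec1_succ (rec1_comp rec1_double (rec_proj A (lift ord0 ord0)))))) _.
move=> v; congr predn; elim: (tnth v ord0) => [|n IHn]; first by rewrite mul1n.
by rewrite iterS -IHn expnS -mulnA mul2n.
Qed.

Lemma iter_half k n : iter k half n = n %/ 2 ^ k.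
Proof.
by elim: k => [|k IHk]; rewrite ?divn1 //= IHk expnSr divnMA divn2.
Qed.

(** The exponent of 2 in n + 1 is the first k for which the k-th half is odd. *)
Lemma rec1_cfst : rec1 cfst.
Proof.
apply: (@rec_mu A 1 (fun v => 1 - odd (iter (tnth v ord0) half (tnth v (lift ord0 ord0)).+1))).
- apply: rec1_comp rec1_not _; apply: rec1_comp rec1_odd _.
  apply: rec2_comp (rec2_iter rec1_half) (rec_proj A _) _.
  exact: rec1_comp rec1_succ (rec_proj A _).
- case/tupleP=> n v; rewrite !(tnth_nth 0) /= iter_half theadE.
  rewrite -[in n.+1](cfst_csndK n) cpairS mulKn ?expn_gt0 //.
  by rewrite /= odd_double.
- case/tupleP=> n v i; rewrite !(tnth_nth 0) /= iter_half theadE => lt_i.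
  rewrite -[n.+1](@divnK (2 ^ i.+1)); last by rewrite pfactor_dvdn.
  by rewrite expnS mulnA mulnK ?expn_gt0 // oddM andbF.
Qed.

Lemma rec1_csnd : rec1 csnd.
Proof.
apply: recursive_ext
  (rec1_comp rec1_half (rec2_comp (rec2_iter rec1_half) rec1_cfst rec1_succ)) _.
by move=> v; rewrite iter_half.
Qed.

Lemma rec1_pairing f g :
  rec1 f -> rec1 g -> rec1 (fun n => cpair (f n) (g n)).
Proof. exact: rec2_comp rec2_cpair. Qed.

(** Replacing a pair by its first component taken twice, once or not at all
    according to the condition, makes the case distinction an iteration. *)
Lemma rec1_if c f g : rec1 c -> rec1 f -> rec1 g ->
  rec1 (fun n => if c n == 0 then g n else f n).
Proof.
move=> Ac Af Ag; set p := fun n => cpair (cfst n) (cfst n).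
have Ap : rec1 p := rec1_pairing rec1_cfst rec1_cfst.
apply: recursive_ext (rec1_comp rec1_csnd (rec2_comp (rec2_iter Ap)
  (rec1_comp rec1_not (rec1_comp rec1_not Ac)) (rec1_pairing Af Ag))) _ => v.
case: (c _) => [|m]; first by rewrite /= cpairK2.
have -> : 1 - (1 - m.+1) = 1 by [].
by rewrite /= cpairK2 cpairK1.
Qed.

Lemma rec1_mu g f : rec1 g ->
  (forall n, g (cpair (f n) n) = 0) ->
  (forall n i, i < f n -> g (cpair i n) <> 0) -> rec1 f.
Proof.
move=> Ag g0 gN0.
apply: (@rec_mu A 1 (fun v => g (cpair (tnth v ord0) (tnth v (lift ord0 ord0))))).
- by apply: rec1_comp Ag _; apply: rec2_comp rec2_cpair _ _; apply: rec_proj.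
- by case/tupleP=> n v; rewrite theadE !(tnth_nth 0) /=.
- by case/tupleP=> n v i; rewrite theadE !(tnth_nth 0) /=; apply: gN0.
Qed.

Lemma rec1_oracle : rec1 A.
Proof. exact: rec_oracle. Qed.

End Unary.

(** * Recursive functions and recursively enumerable predicates on coded types *)

(** The decoding is total, so that a search over numbers is a search over X. *)
Class Coded (X : Type) := { enc : X -> nat; dec : nat -> X; encK : cancel enc dec }.

Lemma enc_inj (X : Type) {cX : Coded X} : injective (enc : X -> nat).
Proof. exact: can_inj encK. Qed.

#[export] Instance coded_nat : Coded nat.
Proof. by exists id id. Defined.

#[export] Instance coded_unit : Coded unit.
Proof. by exists (fun=> 0) (fun=> tt); case. Defined.

#[export] Instance coded_bool : Coded bool := {| encK := oddb |}.

Definition enc_int (i : int) := match i with Posz n => n.*2 | Negz n => n.*2.+1 end.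
Definition dec_int n := if odd n then Negz n./2 else Posz n./2.
Lemma enc_intK : cancel enc_int dec_int.
Proof.
by case=> n; rewrite /dec_int /= odd_double ?doubleK // uphalf_double.
Qed.
#[export] Instance coded_int : Coded int := {| encK := enc_intK |}.

Section Pairs.
Variables (X Y : Type) (cX : Coded X) (cY : Coded Y).

Definition enc_pair (p : X * Y) := cpair (enc p.1) (enc p.2).
Definition dec_pair n : X * Y := (dec (cfst n), dec (csnd n)).
Lemma enc_pairK : cancel enc_pair dec_pair.
Proof. by case=> x y; rewrite /dec_pair cpairK1 cpairK2 !encK. Qed.

Definition enc_sum (p : X + Y) :=
  match p with inl x => cpair 0 (enc x) | inr y => cpair 1 (enc y) end.
Definition dec_sum n : X + Y :=
  if cfst n == 0 then inl (dec (csnd n)) else inr (dec (csnd n)).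
Lemma enc_sumK : cancel enc_sum dec_sum.
Proof. by case=> x; rewrite /dec_sum cpairK1 cpairK2 encK. Qed.

Definition enc_seq (s : seq X) := CodeSeq.code (map enc s).
Definition dec_seq n : seq X := map dec (CodeSeq.decode n).
Lemma enc_seqK : cancel enc_seq dec_seq.
Proof. by move=> s; rewrite /dec_seq CodeSeq.codeK mapK //; apply: encK. Qed.
End Pairs.

#[export] Instance coded_prod X Y (cX : Coded X) (cY : Coded Y) : Coded (X * Y) :=
  {| encK := enc_pairK cX cY |}.
#[export] Instance coded_sum X Y (cX : Coded X) (cY : Coded Y) : Coded (X + Y) :=
  {| encK := enc_sumK cX cY |}.
#[export] Instance coded_seq X (cX : Coded X) : Coded (seq X) :=
  {| encK := enc_seqK cX |}.
#[export] Instance coded_word T (cT : Coded T) : Coded (word T) :=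
  coded_seq (coded_prod cT coded_bool).

Section Computable.
Variable A : pred nat.

Definition computable X Y {cX : Coded X} {cY : Coded Y} (f : X -> Y) :=
  exists2 g, rec1 A g & forall x, g (enc x) = enc (f x).

(** A search through X meets numbers that are not codes; normalizing them has to
    be recursive. *)
Definition listable X {cX : Coded X} := rec1 A (fun n => enc (dec n : X)).

Section Combinators.
Context {X Y Z U : Type} {cX : Coded X} {cY : Coded Y} {cZ : Coded Z} {cU : Coded U}.

Lemma comp_ext (f g : X -> Y) : computable g -> f =1 g -> computable f.
Proof. by case=> h Ah hE fg; exists h => // x; rewrite hE fg. Qed.

Lemma comp_id : computable (fun x : X => x).
Proof. by exists id => //; apply: rec1_id. Qed.

Lemma comp_cst (y : Y) : computable (fun _ : X => y).
Proof. by exists (fun=> enc y) => //; apply: recursive_cst. Qed.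

Lemma comp1 (h : Y -> Z) (f : X -> Y) :
  computable h -> computable f -> computable (fun x => h (f x)).
Proof.
case=> h' Ah hE [f' Af fE]; exists (h' \o f'); first exact: rec1_comp Ah Af.
by move=> x; rewrite /= fE hE.
Qed.

Lemma comp_pair (f : X -> Y) (g : X -> Z) :
  computable f -> computable g -> computable (fun x => (f x, g x)).
Proof.
case=> f' Af fE [g' Ag gE]; exists (fun n => cpair (f' n) (g' n)).
  exact: rec1_pairing.
by move=> x; rewrite fE gE.
Qed.

Lemma comp_fst (f : X -> Y * Z) : computable f -> computable (fun x => (f x).1).
Proof.
case=> f' Af fE; exists (fun n => cfst (f' n)).
  exact: rec1_comp (rec1_cfst A) Af.
by move=> x; rewrite fE /= cpairK1.
Qed.

Lemma comp_snd (f : X -> Y * Z) : computable f -> computable (fun x => (f x).2).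
Proof.
case=> f' Af fE; exists (fun n => csnd (f' n)).
  exact: rec1_comp (rec1_csnd A) Af.
by move=> x; rewrite fE /= cpairK2.
Qed.

Lemma comp_if (b : X -> bool) (f g : X -> Y) :
  computable b -> computable f -> computable g -> computable (fun x => if b x then f x else g x).
Proof.
case=> b' Ab bE [f' Af fE] [g' Ag gE].
exists (fun n => if b' n == 0 then g' n else f' n); first exact: rec1_if.
by move=> x; rewrite bE fE gE; case: (b x).
Qed.

Lemma comp_inl (f : X -> Y) : computable f -> computable (fun x => inl (f x) : Y + Z).
Proof.
case=> f' Af fE; exists (fun n => cpair 0 (f' n)).
  exact: rec1_pairing (rec1_cst A _) Af.
by move=> x; rewrite fE.
Qed.

Lemma comp_inr (f : X -> Z) : computable f -> computable (fun x => inr (f x) : Y + Z).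
Proof.
case=> f' Af fE; exists (fun n => cpair 1 (f' n)).
  exact: rec1_pairing (rec1_cst A _) Af.
by move=> x; rewrite fE.
Qed.

Lemma comp_sumcase (f : X -> Y + Z) (g : X * Y -> U) (h : X * Z -> U) :
  computable f -> computable g -> computable h ->
  computable (fun x => match f x with inl y => g (x, y) | inr z => h (x, z) end).
Proof.
case=> f' Af fE [g' Ag gE] [h' Ah hE].
exists (fun n => if cfst (f' n) == 0 then g' (cpair n (csnd (f' n)))
                 else h' (cpair n (csnd (f' n)))).
  have Ap : rec1 A (fun n => cpair n (csnd (f' n))).
    exact: rec1_pairing (rec1_id A) (rec1_comp (rec1_csnd A) Af).
  apply: (@rec1_if _ (fun n => cfst (f' n))).
  - exact: rec1_comp (rec1_cfst A) Af.
  - exact: rec1_comp Ah Ap.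
  - exact: rec1_comp Ag Ap.
move=> x; rewrite fE; case: (f x) => y /=; rewrite cpairK1 cpairK2 /=.
  by rewrite -gE.
by rewrite -hE.
Qed.

Lemma comp_cons (f : X -> Y) (g : X -> seq Y) :
  computable f -> computable g -> computable (fun x => f x :: g x).
Proof.
case=> f' Af fE [g' Ag gE]; exists (fun n => (cpair (f' n) (g' n)).+1).
  exact: rec1_comp (rec1_succ A) (rec1_pairing Af Ag).
by move=> x; rewrite fE gE /= /enc_seq map_cons code_cons.
Qed.

Lemma comp_seqcase (l : X -> seq Y) (g : X -> Z) (h : X * (Y * seq Y) -> Z) :
  computable l -> computable g -> computable h ->
  computable (fun x => if l x is y :: s then h (x, (y, s)) else g x).
Proof.
case=> l' Al lE [g' Ag gE] [h' Ah hE].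
exists (fun n => if l' n == 0 then g' n else h' (cpair n (l' n).-1)).
  have Ap : rec1 A (fun n => cpair n (l' n).-1).
    exact: rec1_pairing (rec1_id A) (rec1_comp (rec1_pred A) Al).
  exact: rec1_if Al (rec1_comp Ah Ap) Ag.
move=> x; rewrite lE; case: (l x) => [|y s]; first exact: gE.
have -> : enc (y :: s) = (cpair (enc y) (enc s)).+1 by rewrite -code_cons.
exact: hE (x, (y, s)).
Qed.

Lemma comp_iter (h : Y -> Y) (n : X -> nat) (f : X -> Y) :
  computable h -> computable n -> computable f -> computable (fun x => iter (n x) h (f x)).
Proof.
case=> h' Ah hE [n' An nE] [f' Af fE].
exists (fun m => iter (n' m) h' (f' m)); first exact: rec2_comp (rec2_iter Ah) An Af.
by move=> x; rewrite nE fE; elim: (n x) => //= m ->.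
Qed.

End Combinators.

Lemma comp2 (X Y Z U : Type) {cX : Coded X} {cY : Coded Y} {cZ : Coded Z} {cU : Coded U}
    (h : Y -> Z -> U) (f : X -> Y) (g : X -> Z) :
  computable (fun p => h p.1 p.2) -> computable f -> computable g ->
  computable (fun x => h (f x) (g x)).
Proof. by move=> Ch Cf Cg; apply: (comp1 Ch (comp_pair Cf Cg)). Qed.

(** The fold is an iteration on pairs of an accumulator and a rest of the list;
    the code of a list bounds its length, so it is a sufficient number of steps. *)
Lemma comp_foldl (X Y Z : Type) {cX : Coded X} {cY : Coded Y} {cZ : Coded Z}
    (h : X -> Z -> Y -> Z) (z : X -> Z) (l : X -> seq Y) :
  computable (fun p => h p.1 p.2.1 p.2.2) -> computable z -> computable l ->
  computable (fun x => foldl (h x) (z x) (l x)).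
Proof.
move=> Ch Cz Cl; pose st := (X * (Z * seq Y))%type.
pose step (s : st) : st :=
  if s.2.2 is y :: t then (s.1, (h s.1 s.2.1 y, t)) else s.
have Cstep : computable step.
  apply: (comp_seqcase (h := fun p : st * (Y * seq Y) =>
            (p.1.1, (h p.1.1 p.1.2.1 p.2.1, p.2.2)))).
  - exact: comp_snd (comp_snd comp_id).
  - exact: comp_id.
  - apply: comp_pair (comp_fst (comp_fst comp_id)) (comp_pair _ _).
      apply: (comp1 Ch (f := fun p : st * (Y * seq Y) => (p.1.1, (p.1.2.1, p.2.1)))).
      apply: comp_pair (comp_fst (comp_fst comp_id)) (comp_pair _ _).
        exact: comp_fst (comp_snd (comp_fst comp_id)).
      exact: comp_fst (comp_snd comp_id).
    exact: comp_snd (comp_snd comp_id).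
have Cenc : computable (fun x => enc (l x)).
  by case: Cl => l' Al lE; exists l'.
have := comp_fst (comp_snd (comp_iter Cstep Cenc (comp_pair comp_id (comp_pair Cz Cl)))).
move/comp_ext; apply=> x.
have step0 n z0 : iter n step (x, (z0, [::])) = (x, (z0, [::])).
  by elim: n => //= n ->.
have : size (l x) <= enc (l x).
  rewrite /= /enc_seq; elim: (l x) => //= y s IHs.
  rewrite -/(CodeSeq.code _) -cpairS ltnS (leq_trans IHs) // -ltnS cpairS.
  by rewrite -[_.+1]mul1n leq_mul ?expn_gt0 // ltnS -addnn leq_addr.
move: (enc (l x)) => n; elim: (l x) (z x) n => [|y s IHs] z0 n /=.
  by rewrite step0.
case: n => // n; rewrite ltnS iterSr => /IHs -> //.
Qed.

Lemma comp_rev (X Y : Type) {cX : Coded X} {cY : Coded Y} (l : X -> seq Y) :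
  computable l -> computable (fun x => rev (l x)).
Proof.
move=> Cl; apply: (comp_ext (comp_foldl (h := fun _ s y => y :: s)
   (z := fun=> [::]) _ (comp_cst _) Cl)); last first.
  move=> x; rewrite /rev; elim: (l x) [::] => //=.
exact: comp_cons (comp_snd (comp_snd comp_id)) (comp_fst (comp_snd comp_id)).
Qed.

Lemma comp_foldr (X Y Z : Type) {cX : Coded X} {cY : Coded Y} {cZ : Coded Z}
    (h : X -> Y -> Z -> Z) (z : X -> Z) (l : X -> seq Y) :
  computable (fun p => h p.1 p.2.1 p.2.2) -> computable z -> computable l ->
  computable (fun x => foldr (h x) (z x) (l x)).
Proof.
move=> Ch Cz Cl; apply: (comp_ext (comp_foldl (h := fun x u y => h x y u)
   _ Cz (comp_rev Cl))); last by move=> x; rewrite foldl_rev.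
apply: (comp1 Ch (f := fun p : X * (Z * Y) => (p.1, (p.2.2, p.2.1)))).
apply: comp_pair (comp_fst comp_id) (comp_pair _ _).
  exact: comp_snd (comp_snd comp_id).
exact: comp_fst (comp_snd comp_id).
Qed.

End Computable.
Arguments listable A X {cX}.

(** The head of the function is matched before a lemma is applied, because
    unification alone may choose projections of an arbitrary pair. *)
Ltac comp_proj :=
  cbv beta;
  match goal with
  | |- computable _ (@fst _ _) => refine (@comp_fst _ _ _ _ _ _ _ (fun x => x) _); exact: comp_id
  | |- computable _ (@snd _ _) => refine (@comp_snd _ _ _ _ _ _ _ (fun x => x) _); exact: comp_id
  | |- computable _ (fun x => x) => exact: comp_id
  | |- computable _ (fun x => (@?f x, @?g x)) => apply: (comp_pair (f := f) (g := g)); comp_proj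
  | |- computable _ (fun x => fst (@?f x)) => apply: (comp_fst (f := f)); comp_proj
  | |- computable _ (fun x => snd (@?f x)) => apply: (comp_snd (f := f)); comp_proj
  | |- computable _ (fun x => ?c) => exact: comp_cst
  end.

Section Derived.
Variable A : pred nat.
Local Notation computable := (computable A).

Lemma comp_succ X {cX : Coded X} (f : X -> nat) : computable f -> computable (fun x => (f x).+1).
Proof. by apply: comp1; exists succn => //; apply: rec1_succ. Qed.

Lemma comp_double X {cX : Coded X} (f : X -> nat) : computable f -> computable (fun x => (f x).*2).
Proof. by apply: comp1; exists double => //; apply: rec1_double. Qed.

Lemma comp_half X {cX : Coded X} (f : X -> nat) : computable f -> computable (fun x => (f x)./2).
Proof. by apply: comp1; exists half => //; apply: rec1_half. Qed.

Lemma comp_odd X {cX : Coded X} (f : X -> nat) : computable f -> computable (fun x => odd (f x)).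
Proof. by apply: comp1; exists (fun n => odd n) => //; apply: rec1_odd. Qed.

Lemma comp_add X {cX : Coded X} (f g : X -> nat) :
  computable f -> computable g -> computable (fun x => f x + g x).
Proof.
apply: comp2; exists (fun n => cfst n + csnd n).
  exact: rec2_comp (rec2_add A) (rec1_cfst A) (rec1_csnd A).
by case=> m n; rewrite /= cpairK1 cpairK2.
Qed.

Lemma comp_sub X {cX : Coded X} (f g : X -> nat) :
  computable f -> computable g -> computable (fun x => f x - g x).
Proof.
apply: comp2; exists (fun n => cfst n - csnd n).
  exact: rec2_comp (rec2_sub A) (rec1_csnd A) (rec1_cfst A).
by case=> m n; rewrite /= cpairK1 cpairK2.
Qed.

Lemma comp_is0 X {cX : Coded X} (f : X -> nat) : computable f -> computable (fun x => f x == 0).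
Proof. by apply: (comp1 (h := eqn^~ 0)); exists (subn 1) => [|[|n]] //; apply: rec1_not. Qed.

Lemma comp_leq X {cX : Coded X} (f g : X -> nat) :
  computable f -> computable g -> computable (fun x => f x <= g x).
Proof. by move=> Cf Cg; apply: comp_is0; apply: comp_sub. Qed.

Lemma comp_negb X {cX : Coded X} (f : X -> bool) : computable f -> computable (fun x => ~~ f x).
Proof.
move=> Cf; apply: (comp_ext (comp_if Cf (comp_cst _ false) (comp_cst _ true))).
by move=> x; case: (f x).
Qed.

Lemma comp_andb X {cX : Coded X} (f g : X -> bool) :
  computable f -> computable g -> computable (fun x => f x && g x).
Proof. by move=> Cf Cg; apply: comp_if Cf Cg (comp_cst _ false). Qed.

Lemma comp_orb X {cX : Coded X} (f g : X -> bool) :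
  computable f -> computable g -> computable (fun x => f x || g x).
Proof. by move=> Cf Cg; apply: comp_if Cf (comp_cst _ true) Cg. Qed.

Lemma comp_implyb X {cX : Coded X} (f g : X -> bool) :
  computable f -> computable g -> computable (fun x => f x ==> g x).
Proof. by move=> Cf Cg; apply: comp_if Cf Cg (comp_cst _ true). Qed.

Lemma comp_enc X {cX : Coded X} : computable (enc : X -> nat).
Proof. by exists id => //; apply: rec1_id. Qed.

Lemma comp_eq X {cX : Coded X} (Y : eqType) {cY : Coded Y} (f g : X -> Y) :
  computable f -> computable g -> computable (fun x => f x == g x).
Proof.
move=> Cf Cg; have Cef := comp1 (comp_enc (cX := cY)) Cf.
have Ceg := comp1 (comp_enc (cX := cY)) Cg.
apply: (comp_ext (comp_andb (comp_leq Cef Ceg) (comp_leq Ceg Cef))) => x.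
by rewrite -eqn_leq (inj_eq (@enc_inj _ cY)).
Qed.

Lemma comp_mem_cst X {cX : Coded X} (Y : eqType) {cY : Coded Y} (s : seq Y) (f : X -> Y) :
  computable f -> computable (fun x => f x \in s).
Proof.
move=> Cf; elim: s => [|y s IHs]; first exact: comp_cst.
apply: comp_ext (comp_orb (comp_eq Cf (comp_cst _ y)) IHs) _ => x.
by rewrite inE.
Qed.

Section Lists.
Context {X Y Z : Type} {cX : Coded X} {cY : Coded Y} {cZ : Coded Z}.

Lemma comp_map (h : X -> Y -> Z) (l : X -> seq Y) :
  computable (fun p => h p.1 p.2) -> computable l -> computable (fun x => map (h x) (l x)).
Proof.
move=> Ch Cl; apply: (comp_ext (comp_foldr (h := fun x y s => h x y :: s)
  (z := fun=> [::]) _ (comp_cst _ _) Cl)); last by move=> x; elim: (l x) => //= y s ->.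
by apply: comp_cons; [apply: (comp2 Ch)|]; comp_proj.
Qed.

Lemma comp_filter (h : X -> Y -> bool) (l : X -> seq Y) :
  computable (fun p => h p.1 p.2) -> computable l -> computable (fun x => filter (h x) (l x)).
Proof.
move=> Ch Cl; apply: (comp_ext (comp_foldr (h := fun x y s => if h x y then y :: s else s)
  (z := fun=> [::]) _ (comp_cst _ _) Cl)); last by move=> x; elim: (l x) => //= y s ->.
by apply: comp_if; [apply: (comp2 Ch) | apply: comp_cons |]; comp_proj.
Qed.

Lemma comp_all (h : X -> Y -> bool) (l : X -> seq Y) :
  computable (fun p => h p.1 p.2) -> computable l -> computable (fun x => all (h x) (l x)).
Proof.
move=> Ch Cl; apply: (comp_foldr (h := fun x y b => h x y && b)
  (z := fun=> true) _ (comp_cst _ _) Cl).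
by apply: comp_andb; [apply: (comp2 Ch)|]; comp_proj.
Qed.

Lemma comp_has (h : X -> Y -> bool) (l : X -> seq Y) :
  computable (fun p => h p.1 p.2) -> computable l -> computable (fun x => has (h x) (l x)).
Proof.
move=> Ch Cl; apply: (comp_foldr (h := fun x y b => h x y || b)
  (z := fun=> false) _ (comp_cst _ _) Cl).
by apply: comp_orb; [apply: (comp2 Ch)|]; comp_proj.
Qed.

Lemma comp_cat (l1 l2 : X -> seq Y) :
  computable l1 -> computable l2 -> computable (fun x => l1 x ++ l2 x).
Proof.
move=> C1 C2; apply: (comp_ext (comp_foldr (h := fun _ => cons) _ C2 C1)).
  by apply: comp_cons; comp_proj.
by move=> x; elim: (l1 x) => //= y s ->.
Qed.
End Lists.

Lemma comp_flatten {X Y : Type} {cX : Coded X} {cY : Coded Y} (l : X -> seq (seq Y)) :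
  computable l -> computable (fun x => flatten (l x)).
Proof.
move=> Cl; apply: (comp_foldr (h := fun _ => cat) (z := fun=> [::]) _ (comp_cst _ _) Cl).
by apply: comp_cat; comp_proj.
Qed.

Lemma comp_nseq {X Y : Type} {cX : Coded X} {cY : Coded Y} (n : X -> nat) (f : X -> Y) :
  computable n -> computable f -> computable (fun x => nseq (n x) (f x)).
Proof.
move=> Cn Cf.
pose step (p : Y * seq Y) := (p.1, p.1 :: p.2).
have Cstep : computable step by apply: comp_pair; [|apply: comp_cons]; comp_proj.
apply: (comp_ext (comp_snd (comp_iter Cstep Cn (comp_pair Cf (comp_cst _ [::]))))).
move=> x; suff -> : iter (n x) step (f x, [::]) = (f x, nseq (n x) (f x)) by [].
by elim: (n x) => //= m ->.
Qed.

Lemma comp_iota X {cX : Coded X} (f : X -> nat) :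
  computable f -> computable (fun x => iota 0 (f x)).
Proof.
move=> Cf; pose step (p : nat * seq nat) := (p.1.+1, rcons p.2 p.1).
have Cstep : computable step.
  apply: comp_pair; first by apply: comp_succ; comp_proj.
  apply: comp_ext (comp_cat (l1 := fun p => p.2) (l2 := fun p => [:: p.1]) _ _) _.
  - by comp_proj.
  - by apply: comp_cons; comp_proj.
  - by move=> p; rewrite cats1.
apply: (comp_ext (comp_snd (comp_iter Cstep Cf (comp_cst _ (0, [::]))))).
move=> x; suff -> : iter (f x) step (0, [::]) = (f x, iota 0 (f x)) by [].
elim: (f x) => // n IHn; rewrite iterS IHn /step -cats1.
by congr pair; rewrite -[n.+1]addn1 iotaD add0n.
Qed.

(** Enumerability is stated by a computable matrix and one numerical search;
    codes of tuples and lists absorb all other certificates. *)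
Definition re X {cX : Coded X} (P : X -> Prop) :=
  exists2 Q : X * nat -> bool, computable Q & forall x, P x <-> exists n, Q (x, n).

Section Enumerable.
Context {X Y : Type} {cX : Coded X} {cY : Coded Y}.

Lemma re_ext (P Q : X -> Prop) : re Q -> (forall x, P x <-> Q x) -> re P.
Proof. by case=> q Cq qE PQ; exists q => // x; rewrite PQ qE. Qed.

Lemma re_comp (b : X -> bool) : computable b -> re (fun x => b x).
Proof.
move=> Cb; exists (fun p => b p.1); first by apply: (comp1 Cb); comp_proj.
by move=> x; split=> [bx|[n]] //; exists 0.
Qed.

Lemma re_app (f : X -> Y) (P : Y -> Prop) : re P -> computable f -> re (fun x => P (f x)).
Proof.
case=> q Cq qE Cf; exists (fun p => q (f p.1, p.2)); last by move=> x; rewrite qE.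
by apply: (comp1 Cq); apply: comp_pair; [apply: (comp1 Cf)|]; comp_proj.
Qed.

Lemma re_or (P Q : X -> Prop) : re P -> re Q -> re (fun x => P x \/ Q x).
Proof.
case=> p Cp pE [q Cq qE]; exists (fun u => p u || q u); first exact: comp_orb.
move=> x; rewrite pE qE; split=> [[[n pn]|[n qn]]|[n /orP[pn|qn]]].
- by exists n; rewrite pn.
- by exists n; rewrite qn orbT.
- by left; exists n.
- by right; exists n.
Qed.

Lemma re_and (P Q : X -> Prop) : re P -> re Q -> re (fun x => P x /\ Q x).
Proof.
case=> p Cp pE [q Cq qE].
have cst_fst : computable (fun n : nat => (cfst n : nat)).
  by exists cfst => //; apply: rec1_cfst.
have cst_snd : computable (fun n : nat => (csnd n : nat)).
  by exists csnd => //; apply: rec1_csnd.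
exists (fun u => p (u.1, cfst u.2) && q (u.1, csnd u.2)).
  apply: comp_andb; [apply: (comp1 Cp) | apply: (comp1 Cq)]; apply: comp_pair;
  by [comp_proj | apply: (comp1 cst_fst); comp_proj | apply: (comp1 cst_snd); comp_proj].
move=> x; rewrite pE qE; split=> [[[n pn] [m qm]]|[n /andP[pn qn]]].
  by exists (cpair n m); rewrite cpairK1 cpairK2 pn.
by split; [exists (cfst n) | exists (csnd n)].
Qed.

Lemma re_ex (P : X * Y -> Prop) :
  listable A Y -> re P -> re (fun x => exists y, P (x, y)).
Proof.
move=> LY [p Cp pE].
have cst_fst : computable (fun n : nat => dec (cfst n) : Y).
  by exists (fun n => enc (dec (cfst n) : Y)) => //; apply: rec1_comp LY (rec1_cfst A).
have cst_snd : computable (fun n : nat => (csnd n : nat)).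
  by exists csnd => //; apply: rec1_csnd.
exists (fun u => p ((u.1, dec (cfst u.2)), csnd u.2)).
  apply: (comp1 Cp); apply: comp_pair; last by apply: (comp1 cst_snd); comp_proj.
  by apply: comp_pair; last apply: (comp1 cst_fst); comp_proj.
move=> x; split=> [[y /pE[n pn]]|[n pn]].
  by exists (cpair (enc y) n); rewrite cpairK1 cpairK2 encK.
by exists (dec (cfst n)); apply/pE; exists (csnd n).
Qed.

End Enumerable.

(** A single bound serves for the searches belonging to all entries of the list,
    since it may exceed each of the individual ones. *)
Lemma re_all (X : Type) (Y : eqType) {cX : Coded X} {cY : Coded Y}
    (P : X * Y -> Prop) (l : X -> seq Y) :
  re P -> computable l -> re (fun x => forall y, y \in l x -> P (x, y)).
Proof.
case=> p Cp pE Cl.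
exists (fun u => all (fun y => has (fun n => p ((u.1, y), n)) (iota 0 u.2)) (l u.1)).
  apply: comp_all; last by apply: (comp1 Cl); comp_proj.
  apply: comp_has; last by apply: comp_iota; comp_proj.
  by apply: (comp1 Cp); comp_proj.
move=> x; rewrite /=; elim: (l x) => [|y s IHs] /=.
  by split=> // _; exists 0.
split=> [H|[n /andP[/hasP[m mn pm] al]] z].
- have [n al] : exists n, all (fun y1 => has (fun m => p ((x, y1), m)) (iota 0 n)) s.
    by apply/IHs => z zs; apply: H; rewrite inE zs orbT.
  have /pE[m pm] := H y (mem_head _ _).
  exists (maxn n m.+1); apply/andP; split.
    by apply/hasP; exists m => //; rewrite mem_iota leq_max leqnn orbT.
  apply: sub_all al => z /hasP[k]; rewrite mem_iota => /andP[_ kn] pk.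
  by apply/hasP; exists k => //; rewrite mem_iota /= add0n leq_max kn.
- rewrite inE => /predU1P[->|zs]; first by apply/pE; exists m.
  by case: IHs => _ IH; apply: IH => //; exists n.
Qed.

Section Listable.
Variables (X Y : Type) (cX : Coded X) (cY : Coded Y).

Lemma listable_nat : listable A nat.
Proof. exact: rec1_id. Qed.

Lemma listable_bool : listable A bool.
Proof. exact: rec1_odd. Qed.

Lemma listable_unit : listable A unit.
Proof. exact: rec1_cst. Qed.

Lemma listable_int : listable A int.
Proof.
suff decK n : enc_int (dec_int n) = n.
  exact: recursive_ext (rec1_id A) (fun v => decK _).
by rewrite -[in RHS](odd_double_half n) /dec_int; case: (odd n).
Qed.

Lemma listable_prod : listable A X -> listable A Y -> listable A (X * Y).
Proof.
move=> LX LY; apply: rec1_pairing; [exact: rec1_comp LX (rec1_cfst A) |].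
exact: rec1_comp LY (rec1_csnd A).
Qed.

Lemma listable_sum : listable A X -> listable A Y -> listable A (X + Y).
Proof.
move=> LX LY.
have C1 : rec1 A (fun n => cpair 0 (enc (dec (csnd n) : X))).
  exact: rec1_pairing (rec1_cst A 0) (rec1_comp LX (rec1_csnd A)).
have C2 : rec1 A (fun n => cpair 1 (enc (dec (csnd n) : Y))).
  exact: rec1_pairing (rec1_cst A 1) (rec1_comp LY (rec1_csnd A)).
apply: recursive_ext (rec1_if (rec1_cfst A) C2 C1) _ => v.
by rewrite /= /dec_sum; case: eqP.
Qed.

(** A number codes a list of numbers as well, so that normalizing codes of lists
    is a map over such a list. *)
Lemma listable_seq : listable A X -> listable A (seq X).
Proof.
move=> LX; have Cl : computable (fun n : nat => enc (dec n : X)) by exists (fun n => enc (dec n : X)).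
have [g Ag gE] : computable (fun s : seq nat => [seq enc (dec n : X) | n <- s]).
  apply: (comp_map (h := fun _ n => enc (dec n : X))); last exact: comp_id.
  by apply: (comp1 Cl); comp_proj.
apply: recursive_ext Ag _ => v; rewrite -[thead v in RHS]CodeSeq.decodeK.
have := gE (CodeSeq.decode (thead v)); rewrite /= /enc_seq !map_id => ->.
by rewrite /dec_seq -map_comp.
Qed.
End Listable.

End Derived.

Section IntegersComputable.
Local Open Scope ring_scope.
Variable A : pred nat.
Context {X : Type} {cX : Coded X}.

Lemma comp_int_shift (h : nat -> nat) (g : int -> int) (f : X -> int) :
  computable A h -> (forall i, h (enc i) = enc (g i)) ->
  computable A f -> computable A (fun x => g (f x)).
Proof. by move=> [h' Ah hE] gE; apply: comp1; exists h' => // i; rewrite -gE; apply: hE. Qed.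

Lemma comp_int_succ (f : X -> int) : computable A f -> computable A (fun x => f x + 1).
Proof.
move=> Cf; apply: (comp_int_shift (g := fun i => i + 1) _ _ Cf
  (h := fun n => if odd n then if n == 1%N then 0%N else (n - 2)%N else n.+2)).
  apply: comp_if; first by apply: comp_odd; comp_proj.
    apply: comp_if; first by apply: comp_eq; comp_proj.
      by comp_proj.
    by apply: comp_sub; comp_proj.
  by apply: comp_succ; apply: comp_succ; comp_proj.
case=> n; first by rewrite /= odd_double addn1.
case: n => [|n] //; have -> : Negz n.+1 + 1 = Negz n by lia.
by rewrite /= odd_double.
Qed.

Lemma comp_int_pred (f : X -> int) : computable A f -> computable A (fun x => f x - 1).
Proof.
move=> Cf; apply: (comp_int_shift (g := fun i => i - 1) _ _ Cf
  (h := fun n => if odd n then n.+2 else if n == 0%N then 1%N else (n - 2)%N)).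
  apply: comp_if; first by apply: comp_odd; comp_proj.
    by apply: comp_succ; apply: comp_succ; comp_proj.
  apply: comp_if; first by apply: comp_eq; comp_proj.
    by comp_proj.
  by apply: comp_sub; comp_proj.
case=> n; last by rewrite /= odd_double /= ?addn0 ?addn1.
case: n => [|n] //; have -> : Posz n.+1 - 1 = Posz n by lia.
by rewrite /= odd_double /= doubleS subn2.
Qed.

(** With constant bounds the interval is a finite list. *)
Lemma comp_int_range (lo hi : int) (f : X -> int) :
  computable A f -> computable A (fun x => lo <= f x < hi).
Proof.
move=> Cf; pose n := if lo <= hi then `|hi - lo|%N else 0%N.
apply: (comp_ext (comp_mem_cst [seq lo + Posz k | k <- iota 0 n] Cf)) => x.
apply/idP/mapP => [/andP[l h]|[k]]; rewrite /n.
  by exists `|f x - lo|%N; [rewrite mem_iota; case: ifP; lia | lia].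
by rewrite mem_iota; case: ifP; lia.
Qed.
End IntegersComputable.

(** * Words and presented groups *)

Section Words.
Context {T : Type}.
Implicit Types (w v u : word T) (l : T * bool).

Definition linv l := (l.1, ~~ l.2).
Definition winv w : word T := rev (map linv w).

Lemma linvK : involutive linv.
Proof. by case=> a e; rewrite /linv /= negbK. Qed.

Lemma winv_cat w v : winv (w ++ v) = winv v ++ winv w.
Proof. by rewrite /winv map_cat rev_cat. Qed.

Lemma winv_cons l w : winv (l :: w) = rcons (winv w) (linv l).
Proof. by rewrite /winv map_cons rev_cons. Qed.

Lemma winvK : involutive winv.
Proof. by move=> w; rewrite /winv map_rev revK mapK //; apply: linvK. Qed.

Lemma winv_nseq n l : winv (nseq n l) = nseq n (linv l).
Proof. by rewrite /winv map_nseq rev_nseq. Qed.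

Lemma word_in_cat (S : pred T) w v : word_in S (w ++ v) = word_in S w && word_in S v.
Proof. exact: all_cat. Qed.

Lemma word_in_winv (S : pred T) w : word_in S (winv w) = word_in S w.
Proof. by rewrite /word_in all_rev all_map. Qed.

(** Equality in the group presented by the generators T and the relators Rel. The
    relators form an arbitrary set because HNN extensions have infinitely many,
    and free groups none. *)
Inductive eqv (Rel : word T -> Prop) : word T -> word T -> Prop :=
| eqv_refl w : eqv Rel w w
| eqv_sym w v : eqv Rel w v -> eqv Rel v w
| eqv_trans w v u : eqv Rel w v -> eqv Rel v u -> eqv Rel w u
| eqv_pair u v a e : eqv Rel (u ++ (a, e) :: (a, ~~ e) :: v) (u ++ v)
| eqv_rel u v r : Rel r -> eqv Rel (u ++ r ++ v) (u ++ v).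

#[local] Hint Resolve eqv_refl : core.

Definition no_rel : word T -> Prop := fun _ => False.

Lemma eq_modE (R : word T) w v : eq_mod R w v <-> eqv (eq R) w v.
Proof.
split; elim=> {w v}.
- move=> w v []; first by move=> u v' a e; apply/eqv_sym/eqv_pair.
  by move=> u v'; apply/eqv_sym/eqv_rel.
- exact: eqv_refl.
- by move=> w v _; apply: eqv_sym.
- by move=> w v u _ wv _; apply: eqv_trans wv.
- by move=> w; apply: rst_refl.
- by move=> w v _; apply: rst_sym.
- by move=> w v u _ wv _; apply: rst_trans wv.
- by move=> u v a e; apply/rst_sym/rst_step/insert_pair.
- by move=> u v r <-; apply/rst_sym/rst_step/insert_relator.
Qed.

Section Congruence.
Variable Rel : word T -> Prop.

#[export] Instance eqv_equiv : Equivalence (eqv Rel).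
Proof.
split; [exact: eqv_refl | exact: eqv_sym | exact: eqv_trans].
Qed.

Lemma eqv_ctx x y w v : eqv Rel w v -> eqv Rel (x ++ w ++ y) (x ++ v ++ y).
Proof.
elim=> {w v} [w|w v _|w v u _ wv _|u v a e|u v r Rr].
- exact: eqv_refl.
- exact: eqv_sym.
- exact: eqv_trans wv.
- by have := eqv_pair Rel (x ++ u) (v ++ y) a e; rewrite -!catA.
- by have := eqv_rel (x ++ u) (v ++ y) Rr; rewrite -!catA.
Qed.

#[export] Instance eqv_cat : Proper (eqv Rel ==> eqv Rel ==> eqv Rel) cat.
Proof.
move=> w w' ww' v v' vv'; apply: (@eqv_trans _ _ (w' ++ v)).
  exact: (eqv_ctx [::] v ww').
by have := eqv_ctx w' [::] vv'; rewrite !cats0.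
Qed.

Lemma eqv_linvr l : eqv Rel [:: l; linv l] [::].
Proof. by case: l => a e; apply: (eqv_pair Rel [::] [::]). Qed.

Lemma eqv_linvl l : eqv Rel [:: linv l; l] [::].
Proof. by have := eqv_linvr (linv l); rewrite linvK. Qed.

Lemma eqv_relator r : Rel r -> eqv Rel r [::].
Proof. by move=> /(eqv_rel [::] [::]); rewrite cats0. Qed.

Lemma eqv_mulV w : eqv Rel (w ++ winv w) [::].
Proof.
elim: w => [|l w IHw]; first exact: eqv_refl.
have -> : (l :: w) ++ winv (l :: w) = [:: l] ++ (w ++ winv w) ++ [:: linv l].
  by rewrite winv_cons -cats1 -!catA.
by rewrite IHw; apply: eqv_linvr.
Qed.

Lemma eqv_Vmul w : eqv Rel (winv w ++ w) [::].
Proof. by have := eqv_mulV (winv w); rewrite winvK. Qed.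

Lemma eqv_mulKr w v u : eqv Rel (w ++ u) (v ++ u) -> eqv Rel w v.
Proof.
move=> wv; have : eqv Rel ((w ++ u) ++ winv u) ((v ++ u) ++ winv u) by rewrite wv.
by rewrite -!catA eqv_mulV !cats0.
Qed.

Lemma eqv_mulKl u w v : eqv Rel (u ++ w) (u ++ v) -> eqv Rel w v.
Proof.
move=> wv; have : eqv Rel (winv u ++ (u ++ w)) (winv u ++ (u ++ v)) by rewrite wv.
by rewrite !catA eqv_Vmul.
Qed.

Lemma eqv_divP w v : eqv Rel (w ++ winv v) [::] <-> eqv Rel w v.
Proof.
split=> [wv|->]; last exact: eqv_mulV.
by apply: (@eqv_mulKr _ _ (winv v)); rewrite wv eqv_mulV.
Qed.

Lemma eqv_conjV x u v : eqv Rel (x ++ u) (v ++ x) -> eqv Rel (x ++ winv u) (winv v ++ x).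
Proof.
move=> xu; apply: (@eqv_mulKl v); apply: (@eqv_mulKr _ _ u).
by rewrite !catA eqv_mulV -xu -!catA eqv_Vmul cats0.
Qed.

#[export] Instance eqv_winv : Proper (eqv Rel ==> eqv Rel) winv.
Proof.
move=> w v wv; apply: (@eqv_mulKl w); rewrite eqv_mulV wv; symmetry.
exact: eqv_mulV.
Qed.
End Congruence.

Lemma eqv_mono (Rel Rel' : word T -> Prop) w v :
  (forall r, Rel r -> eqv Rel' r [::]) -> eqv Rel w v -> eqv Rel' w v.
Proof.
move=> sub; elim=> {w v} [w|w v _|w v u _ wv _|u v a e|u v r Rr].
- exact: eqv_refl.
- exact: eqv_sym.
- exact: eqv_trans wv.
- exact: eqv_pair.
- by rewrite (sub r Rr).
Qed.

Lemma eqv_free (Rel : word T -> Prop) w v : eqv no_rel w v -> eqv Rel w v.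
Proof. exact: eqv_mono. Qed.

(** Elements of the group are words up to [eqv]; accordingly the subgroup
    generated by S consists of the words equal to some S-word. *)
Definition mem_sub Rel (S : pred T) w := exists2 v, word_in S v & eqv Rel w v.

Lemma mem_sub1 Rel (S : pred T) : mem_sub Rel S [::].
Proof. by exists [::]; last exact: eqv_refl. Qed.

Lemma mem_sub_eqv Rel (S : pred T) w v : eqv Rel w v -> mem_sub Rel S w <-> mem_sub Rel S v.
Proof. by move=> wv; split=> -[u Su uE]; exists u => //; rewrite -?wv // wv. Qed.

#[export] Instance mem_sub_proper Rel (S : pred T) : Proper (eqv Rel ==> iff) (mem_sub Rel S).
Proof. by move=> w v; apply: mem_sub_eqv. Qed.

Lemma mem_subM Rel (S : pred T) w v :
  mem_sub Rel S w -> mem_sub Rel S v -> mem_sub Rel S (w ++ v).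
Proof.
move=> [w' Sw wE] [v' Sv vE]; exists (w' ++ v'); first by rewrite word_in_cat Sw.
by rewrite wE vE.
Qed.

Lemma mem_subV Rel (S : pred T) w : mem_sub Rel S w -> mem_sub Rel S (winv w).
Proof.
by move=> [w' Sw wE]; exists (winv w'); rewrite ?word_in_winv // wE.
Qed.

Lemma mem_sub_word Rel (S : pred T) w : word_in S w -> mem_sub Rel S w.
Proof. by exists w. Qed.

Lemma mem_sub_none Rel w : mem_sub Rel pred0 w <-> eqv Rel w [::].
Proof.
split=> [[[|l v] //]|w1]; by exists [::].
Qed.
End Words.

#[export] Existing Instances eqv_equiv eqv_cat eqv_winv mem_sub_proper.
#[export] Hint Resolve eqv_refl : core.

(** * Homomorphisms of presented groups *)

Section Substitution.
Context {T T' : Type}.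
Variable f : T -> word T'.

Definition lsubst (l : T * bool) := if l.2 then winv (f l.1) else f l.1.
Definition subst (w : word T) : word T' := flatten (map lsubst w).

Lemma subst_cat w v : subst (w ++ v) = subst w ++ subst v.
Proof. by rewrite /subst map_cat flatten_cat. Qed.

Lemma subst_cons l w : subst (l :: w) = lsubst l ++ subst w.
Proof. by []. Qed.

Lemma subst1 l : subst [:: l] = lsubst l.
Proof. by rewrite subst_cons cats0. Qed.

Lemma lsubst_inv l : lsubst (linv l) = winv (lsubst l).
Proof. by case: l => a []; rewrite /lsubst /= ?winvK. Qed.

Lemma subst_winv w : subst (winv w) = winv (subst w).
Proof.
elim: w => // l w IHw.
by rewrite winv_cons -cats1 subst_cat IHw subst1 lsubst_inv -winv_cat.
Qed.

(** A map of generators to words that kills the relators induces a homomorphism. *)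
Lemma eqv_subst (Rel : word T -> Prop) (Rel' : word T' -> Prop) w v :
  (forall r, Rel r -> eqv Rel' (subst r) [::]) ->
  eqv Rel w v -> eqv Rel' (subst w) (subst v).
Proof.
move=> sub; elim=> {w v} [w|w v _|w v u _ wv _|u v a e|u v r Rr].
- exact: eqv_refl.
- exact: eqv_sym.
- exact: eqv_trans wv.
- rewrite !subst_cat !subst_cons (lsubst_inv (a, e)) [lsubst (a, e) ++ _]catA.
  by rewrite eqv_mulV.
- by rewrite !subst_cat (sub r Rr).
Qed.

Lemma word_in_subst (S : pred T) (S' : pred T') w :
  (forall a, S a -> word_in S' (f a)) -> word_in S w -> word_in S' (subst w).
Proof.
move=> SS'; elim: w => //= -[a e] w IHw /andP[/= Sa /IHw Sw].
by rewrite subst_cons word_in_cat Sw /lsubst; case: e; rewrite ?word_in_winv SS'.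
Qed.
End Substitution.

(** * Free reduction *)

Section Reduction.
Context {T : eqType}.
Implicit Types (w v u : word T) (l : T * bool).

Definition reduced w := sorted (fun l l' => l' != linv l) w.

Definition push l w : word T :=
  if w is l' :: w' then if l' == linv l then w' else l :: w else [:: l].
Definition free_reduce w := foldr push [::] w.

Lemma reduced_cons l w :
  reduced (l :: w) = reduced w && (if w is l' :: _ then l' != linv l else true).
Proof. by case: w => //= l' w; rewrite andbC. Qed.

Lemma reduced_push l w : reduced w -> reduced (push l w).
Proof.
case: w => //= l' w red; case: eqP => [_|/eqP neq]; first exact: path_sorted red.
by rewrite /reduced /= neq.
Qed.

Lemma reduced_free_reduce w : reduced (free_reduce w).
Proof. by elim: w => //= l w; apply: reduced_push. Qed.

(** On reduced words the letters act by permutations; therefore the reduced form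
    does not change when a pair of inverse letters is inserted. *)
Lemma pushK l w : reduced w -> push l (push (linv l) w) = w.
Proof.
case: w => [|l' w] /=; rewrite ?linvK ?eqxx // => red.
case: eqP => [ll'|_] /=; last by rewrite eqxx.
case: w red => [|l'' w] /=; first by rewrite ll'.
by rewrite ll' => /andP[/negbTE -> _].
Qed.

Lemma free_reduce_pair u v l : free_reduce (u ++ l :: linv l :: v) = free_reduce (u ++ v).
Proof. by rewrite /free_reduce !foldr_cat /= pushK //; apply: reduced_free_reduce. Qed.

Lemma eqv_push Rel l w : eqv Rel (push l w) (l :: w).
Proof.
case: w => //= l' w; case: eqP => [->|//].
by symmetry; rewrite -[l :: _]/([:: l; linv l] ++ w) eqv_linvr.
Qed.

Lemma eqv_free_reduce Rel w : eqv Rel (free_reduce w) w.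
Proof.
by elim: w => //= l w IHw; rewrite eqv_push -cat1s IHw.
Qed.

Lemma eqv_freeP w v : eqv no_rel w v <-> free_reduce w = free_reduce v.
Proof.
split=> [|wv]; last by rewrite -(eqv_free_reduce _ w) wv eqv_free_reduce.
elim=> {w v} // [w v u _ -> _ //|u v a e].
by rewrite (free_reduce_pair u v (a, e)).
Qed.

Definition conj_prod (s : seq (word T * word T)) : word T :=
  flatten [seq p.1 ++ p.2 ++ winv p.1 | p <- s].

(** The normal closure of the relators consists of the products of conjugates of
    relators and their inverses. Since equality in the free group is decided by
    free reduction, this is the certificate that makes equality enumerable. *)
Lemma eqv_conj_prodP Rel w v : eqv Rel w v <->
  exists s, free_reduce (w ++ winv v) = free_reduce (conj_prod s) /\
    (forall p, p \in s -> Rel p.2 \/ Rel (winv p.2)).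
Proof.
split; last first.
  move=> [s [/eqv_freeP wv Rs]]; apply/eqv_divP; rewrite (eqv_free Rel wv).
  elim: s Rs {wv} => // p s IHs Rs.
  rewrite /conj_prod /= -/(conj_prod s) IHs ?cats0; last first.
    by move=> q qs; apply: Rs; rewrite inE qs orbT.
  have -> : eqv Rel p.2 [::]; last exact: eqv_mulV.
  have [|/eqv_relator rel] := Rs p (mem_head _ _); first exact: eqv_relator.
  by rewrite -[p.2]winvK rel.
elim=> {w v} [w|w v _ [s [/eqv_freeP wv Rs]]|
  w v u _ [s [/eqv_freeP wv Rs]] _ [t [/eqv_freeP vu Rt]]|u v a e|u v r Rr].
- by exists [::]; split=> //; apply/eqv_freeP/eqv_mulV.
- exists (rev [seq (p.1, winv p.2) | p <- s]); split; last first.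
    move=> p; rewrite mem_rev => /mapP[q /Rs Rq ->] /=; rewrite winvK.
    by case: Rq; [right | left].
  apply/eqv_freeP; rewrite -{1}[v]winvK -winv_cat wv.
  elim: s {wv Rs} => // p s IHs.
  rewrite /conj_prod /= -/(conj_prod s) winv_cat IHs rev_cons -cats1.
  rewrite /conj_prod map_cat flatten_cat /= cats0 !winv_cat winvK.
  by rewrite -catA.
- exists (s ++ t); split; last first.
    by move=> p; rewrite mem_cat => /orP[/Rs|/Rt].
  apply/eqv_freeP; rewrite /conj_prod map_cat flatten_cat -/(conj_prod s) -/(conj_prod t).
  by rewrite -wv -vu -catA [winv v ++ _]catA eqv_Vmul.
- exists [::]; split=> //; apply/eqv_freeP.
  by rewrite (eqv_pair no_rel) eqv_mulV.
- exists [:: (u, r)]; split; last by move=> p; rewrite inE => /eqP->; left.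
  apply/eqv_freeP; rewrite /conj_prod /= cats0 winv_cat -!catA [v ++ _]catA.
  by rewrite eqv_mulV.
Qed.
End Reduction.

(** * Enumerability of equality in a presented group *)

Section ComputableWords.
Variable A : pred nat.
Local Notation computable := (computable A).
Local Notation re := (re A).

Lemma comp_linv {X T : Type} {cX : Coded X} {cT : Coded T} (f : X -> T * bool) :
  computable f -> computable (fun x => linv (f x)).
Proof.
move=> Cf; apply: comp_pair; first exact: comp_fst.
by apply: comp_negb; apply: comp_snd.
Qed.

Lemma comp_winv {X T : Type} {cX : Coded X} {cT : Coded T} (f : X -> word T) :
  computable f -> computable (fun x => winv (f x)).
Proof.
move=> Cf; apply: comp_rev; apply: (comp_map (h := fun _ => linv)) => //.
by apply: comp_linv; comp_proj.
Qed.

Lemma comp_subst {X T T' : Type} {cX : Coded X} {cT : Coded T} {cT' : Coded T'}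
    (f : T -> word T') (w : X -> word T) :
  computable f -> computable w -> computable (fun x => subst f (w x)).
Proof.
move=> Cf Cw; apply: comp_flatten; apply: (comp_map (h := fun _ => lsubst f)) => //.
have C1 : computable (fun p : X * (T * bool) => f p.2.1).
  by apply: (comp1 Cf); comp_proj.
apply: comp_if; [by comp_proj | exact: comp_winv | exact: C1].
Qed.

Lemma comp_free_reduce {X : Type} {T : eqType} {cX : Coded X} {cT : Coded T} (w : X -> word T) :
  computable w -> computable (fun x => free_reduce (w x)).
Proof.
move=> Cw; apply: (comp_foldr (h := fun _ => push) (z := fun=> [::])) => //.
  pose st := (X * ((T * bool) * word T))%type.
  apply: (comp_seqcase (g := fun p : st => [:: p.2.1])
    (h := fun q : st * ((T * bool) * word T) =>
       if q.2.1 == linv q.1.2.1 then q.2.2 else q.1.2.1 :: q.1.2.2)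
    (l := fun p => p.2.2)).
  - by comp_proj.
  - by apply: comp_cons; comp_proj.
  - apply: comp_if; [apply: comp_eq | | apply: comp_cons]; try comp_proj.
    by apply: comp_linv; comp_proj.
exact: comp_cst.
Qed.

Lemma re_eqv {T : eqType} {cT : Coded T} (Rel : word T -> Prop) :
  listable A T -> re Rel -> re (fun p : word T * word T => eqv Rel p.1 p.2).
Proof.
move=> LT rRel.
have LW : listable A (word T) by apply: listable_seq; apply: listable_prod LT (listable_bool A).
pose cert := seq (word T * word T).
have LC : listable A cert by apply: listable_seq; apply: listable_prod.
pose P (q : (word T * word T) * cert) :=
  free_reduce (q.1.1 ++ winv q.1.2) == free_reduce (conj_prod q.2) /\
  (forall p, p \in q.2 -> Rel p.2 \/ Rel (winv p.2)).
apply: (@re_ext _ _ _ _ (fun p => exists s, P (p, s))); last first.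
  move=> p; rewrite eqv_conj_prodP; split=> -[s [E Rs]]; exists s; split=> //.
    exact/eqP.
  exact/eqP.
apply: (re_ex LC); apply: re_and.
  apply: re_comp; apply: comp_eq; apply: comp_free_reduce.
    by apply: comp_cat; [|apply: comp_winv]; comp_proj.
  apply: comp_flatten;
    apply: (comp_map (h := fun _ (p : word T * word T) => p.1 ++ p.2 ++ winv p.1));
    last by comp_proj.
  apply: comp_cat; [|apply: comp_cat; [|apply: comp_winv]]; by comp_proj.
pose P' (u : ((word T * word T) * cert) * (word T * word T)) := Rel u.2.2 \/ Rel (winv u.2.2).
apply: (re_all (P := P') (l := fun q : (word T * word T) * cert => q.2)); last by comp_proj.
apply: re_or; apply: (re_app rRel); last apply: comp_winv; by comp_proj.
Qed.
End ComputableWords.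

(** * HNN extensions *)

(** An action of the letters on the points of a set, up to an equivalence, is
    an action of the presented group as soon as the relators act trivially. *)
Section Action.
Variables (T : Type) (Rel : word T -> Prop) (Om : Type) (f : T * bool -> Om -> Om).
Variables (valid : Om -> Prop) (same : Om -> Om -> Prop).
Hypothesis same_equiv : Equivalence same.
Hypothesis f_valid : forall l s, valid s -> valid (f l s).
Hypothesis f_same : forall l s s', same s s' -> same (f l s) (f l s').
Hypothesis f_inv : forall l s, valid s -> same (f l (f (linv l) s)) s.
Hypothesis f_rel : forall r s, Rel r -> valid s -> same (foldr f s r) s.

Lemma act_valid w s : valid s -> valid (foldr f s w).
Proof. by move=> Vs; elim: w => //= l w; apply: f_valid. Qed.

Lemma act_same w s s' : same s s' -> same (foldr f s w) (foldr f s' w).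
Proof. by move=> ss'; elim: w => //= l w; apply: f_same. Qed.

Lemma act_eqv w v s : eqv Rel w v -> valid s -> same (foldr f s w) (foldr f s v).
Proof.
move=> wv Vs; elim: wv => {w v} [w|w v _|w v u _ wv _ vu|u v a e|u v r Rr].
- by reflexivity.
- by symmetry.
- by transitivity (foldr f s v).
- rewrite !foldr_cat; apply: act_same => /=.
  exact: (f_inv (a, e) (act_valid v Vs)).
- by rewrite !foldr_cat; apply: act_same; apply: f_rel => //; apply: act_valid.
Qed.
End Action.

Section HNN.
Variables (TK : countType) (J : countType) (relK : word TK -> Prop).
Local Notation E := (J * bool)%type.
(* The stable letter j conjugates the subgroup generated by assoc (j, false) to
   the one generated by assoc (j, true), along the map sh of generators. The
   signed stable letters e and linv e exchange the two subgroups. *)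
Variables (assoc : E -> pred TK) (sh : E -> TK -> TK).
Hypothesis sh_assoc : forall e y, assoc e y -> assoc (linv e) (sh e y).
Hypothesis shK : forall e y, assoc e y -> sh (linv e) (sh e y) = y.
Local Notation shw e := (map (fun l => (sh e l.1, l.2))).
Hypothesis sh_triv : forall e w,
  word_in (assoc e) w -> eqv relK w [::] -> eqv relK (shw e w) [::].

Local Notation inA e := (mem_sub relK (assoc e)).

Lemma shw_winv e w : shw e (winv w) = winv (shw e w).
Proof. by rewrite /winv map_rev -!map_comp. Qed.

Lemma shw_assoc e w : word_in (assoc e) w -> word_in (assoc (linv e)) (shw e w).
Proof. by rewrite /word_in all_map; apply: sub_all => l /sh_assoc. Qed.

Lemma shw_eqv e w v : word_in (assoc e) w -> word_in (assoc e) v ->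
  eqv relK w v -> eqv relK (shw e w) (shw e v).
Proof.
move=> Aw Av wv; apply/eqv_divP; rewrite -shw_winv -map_cat; apply: sh_triv.
  by rewrite word_in_cat Aw word_in_winv.
exact/eqv_divP.
Qed.

(** The isomorphism between the associated subgroups, extended by 1. *)
Definition phi e w : word TK :=
  if pselect (inA e w) is left Aw then shw e (s2val (cid2 Aw)) else [::].

Lemma phiE e w v : word_in (assoc e) v -> eqv relK w v -> eqv relK (phi e w) (shw e v).
Proof.
move=> Av wv; rewrite /phi; case: pselect => [Aw|[]]; last by exists v.
case: (cid2 Aw) => u /= Au wu; apply: shw_eqv => //.
by rewrite -wu.
Qed.

Lemma phi_eqv e w v : inA e w -> eqv relK w v -> eqv relK (phi e w) (phi e v).
Proof.
by move=> [u Au wu] wv; rewrite (phiE Au wu) (phiE (w := v) Au) // -wv.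
Qed.

Lemma phiM e w v : inA e w -> inA e v -> eqv relK (phi e (w ++ v)) (phi e w ++ phi e v).
Proof.
move=> [w' Aw wE] [v' Av vE]; rewrite (phiE Aw wE) (phiE Av vE) -map_cat.
by apply: phiE; [rewrite word_in_cat Aw | rewrite wE vE].
Qed.

Lemma phi_inA e w : inA e w -> inA (linv e) (phi e w).
Proof.
by move=> [v Av wv]; exists (shw e v); [apply: shw_assoc | apply: phiE].
Qed.

Lemma phiK e w : inA e w -> eqv relK (phi (linv e) (phi e w)) w.
Proof.
move=> [v Av wv]; rewrite (phiE (shw_assoc Av) (phiE Av wv)) -map_comp wv.
suff -> : map ((fun l => (sh (linv e) l.1, l.2)) \o (fun l => (sh e l.1, l.2))) v = v by [].
elim: v Av {wv} => //= -[a b] v IHv /andP[/= Aa /IHv ->].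
by rewrite shK.
Qed.

Lemma inA_mulr e w v : inA e v -> inA e (w ++ v) <-> inA e w.
Proof.
move=> Av; split=> [Awv|Aw]; last exact: mem_subM.
by have := mem_subM Awv (mem_subV Av); rewrite -catA eqv_mulV cats0.
Qed.

Lemma inA_mull e w v : inA e w -> inA e (w ++ v) <-> inA e v.
Proof.
move=> Aw; split=> [Awv|Av]; last exact: mem_subM.
by have := mem_subM (mem_subV Aw) Awv; rewrite catA eqv_Vmul.
Qed.

(** Canonical words for the elements of the base group and for the right
    cosets of the associated subgroups. *)
Definition canon w : word TK := choose (fun v => `[< eqv relK w v >]) w.
Definition coset_rep e w : word TK := choose (fun v => `[< inA e (w ++ winv v) >]) w.

Lemma canonP w : eqv relK (canon w) w.
Proof.
suff /asboolP : `[< eqv relK w (canon w) >] by symmetry.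
by apply: (@chooseP _ (fun v => `[< eqv relK w v >])); apply/asboolP.
Qed.

Lemma canon_eq w v : canon w = canon v <-> eqv relK w v.
Proof.
split=> [E|wv]; first by rewrite -(canonP w) E canonP.
rewrite /canon; transitivity (choose (fun u => `[< eqv relK w u >]) v).
  by apply: choose_id; apply/asboolP; rewrite ?wv.
by apply: eq_choose => u; apply: asbool_equiv_eq; rewrite wv.
Qed.

Lemma canon_id w : canon (canon w) = canon w.
Proof. by apply/canon_eq/canonP. Qed.

Lemma coset_repP e w : inA e (w ++ winv (coset_rep e w)).
Proof.
suff /asboolP : `[< inA e (w ++ winv (coset_rep e w)) >] by [].
apply: (@chooseP _ (fun v => `[< inA e (w ++ winv v) >])); apply/asboolP.
by rewrite eqv_mulV; apply: mem_sub1.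
Qed.

Lemma coset_rep_eq e w v : inA e (w ++ winv v) -> coset_rep e w = coset_rep e v.
Proof.
move=> Awv; rewrite /coset_rep; transitivity (choose (fun u => `[< inA e (w ++ winv u) >]) v).
  apply: choose_id; apply/asboolP => //.
  by rewrite eqv_mulV; apply: mem_sub1.
apply: eq_choose => u; apply: asbool_equiv_eq.
rewrite -(@inA_mull e (w ++ winv v) (v ++ winv u)) //.
by rewrite -catA [winv v ++ _]catA eqv_Vmul; reflexivity.
Qed.

Lemma coset_rep_id e w : coset_rep e (coset_rep e w) = coset_rep e w.
Proof. exact: esym (coset_rep_eq (coset_repP e w)). Qed.

Lemma inA_coset_rep e w : inA e (coset_rep e w) <-> inA e w.
Proof.
rewrite -(@inA_mull e (w ++ winv (coset_rep e w)) (coset_rep e w)); last exact: coset_repP.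
by rewrite -catA eqv_Vmul cats0; reflexivity.
Qed.

(** A state (h, [:: (e1, r1); ...; (en, rn)]) stands for the normal form
    h e1 r1 ... en rn, whose syllables ri are coset representatives. *)
Local Notation state := (word TK * seq (E * word TK))%type.

Definition starts e (L : seq (E * word TK)) := if L is p :: _ then p.1 == e else false.

(** A pinch is a subword e h (linv e) with h in the subgroup associated to e. *)
Fixpoint pinch_free (L : seq (E * word TK)) : Prop :=
  if L is (e, h) :: L' then
    (starts (linv e) L' -> ~ inA e h) /\ pinch_free L'
  else True.

Definition nf_valid (s : state) :=
  [/\ canon s.1 = s.1, all (fun p => coset_rep p.1 p.2 == p.2) s.2 & pinch_free s.2].

(** Multiplication on the left by the stable letter e: split h into an element of
    the associated subgroup, which passes through e by phi, and a coset
    representative; a pinch is cancelled. *)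
Definition nf_stable e (s : state) : state :=
  if `[< inA e s.1 >] && starts (linv e) s.2 then
    (canon (phi e s.1 ++ (head (e, [::]) s.2).2), behead s.2)
  else (canon (phi e (s.1 ++ winv (coset_rep e s.1))), (e, coset_rep e s.1) :: s.2).

Local Notation L := (TK + J)%type.
Definition nf_act (l : L * bool) (s : state) : state :=
  match l.1 with
  | inl y => (canon ((y, l.2) :: s.1), s.2)
  | inr j => nf_stable (j, l.2) s
  end.

Definition inl_word : word TK -> word L := map (fun l => (inl l.1, l.2)).

Inductive hnn_rel : word L -> Prop :=
| hnn_rel_base r : relK r -> hnn_rel (inl_word r)
| hnn_rel_stable j y : assoc (j, false) y ->
    hnn_rel [:: (inr j, false); (inl y, false); (inr j, true); (inl (sh (j, false) y), true)].

Lemma nf_stable_valid e s : nf_valid s -> nf_valid (nf_stable e s).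
Proof.
case: s => h M [/= hE repM pfM]; rewrite /nf_stable /=; case: asboolP => /= [Ah|nAh]; last first.
  split; rewrite /= ?canon_id ?coset_rep_id ?eqxx //; split=> // _.
  by rewrite inA_coset_rep.
case: M repM pfM => [|[e' r] M] /= repM pfM.
  by split; rewrite /= ?canon_id ?coset_rep_id ?eqxx.
case: eqP => [_|/eqP neq].
  by split; rewrite /= ?canon_id //; case/andP: repM; case: pfM.
split; rewrite /= ?canon_id ?coset_rep_id ?eqxx //; split=> //.
by rewrite (negbTE neq).
Qed.

Lemma nf_act_valid l s : nf_valid s -> nf_valid (nf_act l s).
Proof.
case: l => [[y|j] b]; last exact: nf_stable_valid.
by move=> [sE rs ps]; split; rewrite ?canon_id.
Qed.

(** Without a pinch, what the letter linv e has pushed onto the normal form is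
    what e takes away, and conversely. *)
Lemma nf_stableK e s : nf_valid s -> nf_stable e (nf_stable (linv e) s) = s.
Proof.
case: s => h M [/= hE repM pfM]; rewrite {2}/nf_stable /= linvK.
case: ifP => [/andP[/asboolP Ah]|_].
  case: M repM pfM => // -[e' r] M /= /andP[/eqP rE repM] [pf pfM] /eqP e'E.
  move: rE pf; rewrite {}e'E => rE pf.
  have Ap : inA e (phi (linv e) h) by rewrite -{1}[e]linvK; apply: phi_inA.
  have rE' : coset_rep e (canon (phi (linv e) h ++ r)) = r.
    rewrite -[RHS]rE; apply: coset_rep_eq; rewrite canonP -catA eqv_mulV cats0.
    exact: Ap.
  rewrite /nf_stable /= rE'; case: ifP => [/andP[/asboolP Ar st]|_].
    by rewrite canonP inA_mull // in Ar; case: (pf st Ar).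
  congr pair; rewrite -[RHS]hE; apply/canon_eq; have := phiK Ah; rewrite linvK.
  apply: eqv_trans; apply: phi_eqv; last by rewrite canonP -catA eqv_mulV cats0.
  by rewrite canonP -catA eqv_mulV cats0.
have Ah := coset_repP (linv e) h; set g := h ++ _ in Ah *.
have Ap : inA e (canon (phi (linv e) g)).
  by rewrite canonP -{1}[e]linvK; apply: phi_inA.
rewrite /nf_stable /= eqxx; case: asboolP => // _ /=.
congr pair; rewrite -[RHS]hE; apply/canon_eq.
have -> : eqv relK (phi e (canon (phi (linv e) g))) g.
  have := phiK Ah; rewrite linvK; apply: eqv_trans.
  by apply: phi_eqv => //; apply: canonP.
by rewrite /g -catA eqv_Vmul cats0.
Qed.

Lemma nf_actK l s : nf_valid s -> nf_act l (nf_act (linv l) s) = s.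
Proof.
case: l => [[y|j] b] Vs; last exact: (nf_stableK (j, b)).
case: s Vs => h M [/= hE _ _]; rewrite /nf_act /=; congr pair.
rewrite -[RHS]hE; apply/canon_eq; rewrite -[_ :: canon _]cat1s canonP.
by rewrite -[_ ++ _]/([:: (y, b); linv (y, b)] ++ h) eqv_linvr.
Qed.

Lemma nf_act_inl w s : nf_valid s -> foldr nf_act s (inl_word w) = (canon (w ++ s.1), s.2).
Proof.
case: s => h M [/= hE _ _]; elim: w => [|[y b] w IHw] /=; first by rewrite hE.
rewrite IHw /nf_act /=; congr pair; apply/canon_eq.
by rewrite -[_ :: canon _]cat1s canonP.
Qed.

(** The defining relation of the stable letter, as an identity of actions. *)
Lemma nf_act_shift j y s : nf_valid s -> assoc (j, false) y ->
  nf_stable (j, false) (nf_act (inl y, false) s) =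
  nf_act (inl (sh (j, false) y), false) (nf_stable (j, false) s).
Proof.
set e := (j, false); case: s => h M [/= hE _ _] Ay.
have Ay' : inA e [:: (y, false)] by apply: mem_sub_word; rewrite /word_in /= Ay.
have phiy : eqv relK (phi e [:: (y, false)]) [:: (sh e y, false)].
  by apply: (phiE (v := [:: (y, false)])); rewrite /word_in /= ?Ay.
have Ayh : inA e (canon ((y, false) :: h)) <-> inA e h.
  by rewrite canonP -cat1s inA_mull //; reflexivity.
have repy : coset_rep e (canon ((y, false) :: h)) = coset_rep e h.
  apply: coset_rep_eq; rewrite canonP -cat1s -catA eqv_mulV cats0; exact: Ay'.
rewrite /nf_stable /nf_act /= (asbool_equiv_eq Ayh) repy.
case: ifP => [/andP[/asboolP Ah _]|_] /=; congr pair; apply/canon_eq.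
  rewrite -[_ :: canon _]cat1s (canonP (phi e h ++ _)) catA -phiy -phiM //.
  apply: eqv_cat => //; apply: phi_eqv; first by rewrite Ayh.
  by rewrite canonP.
rewrite -[_ :: canon _]cat1s (canonP (phi e _)) -phiy -phiM //; last exact: coset_repP.
have E1 : eqv relK (canon ((y, false) :: h) ++ winv (coset_rep e h))
    ([:: (y, false)] ++ h ++ winv (coset_rep e h)).
  by rewrite canonP.
apply: phi_eqv => //; rewrite E1 inA_mull //; exact: coset_repP.
Qed.

Lemma nf_act_rel r s : hnn_rel r -> nf_valid s -> foldr nf_act s r = s.
Proof.
case=> {r} [r Rr|j y Ay] Vs.
  rewrite nf_act_inl //; case: s Vs => h M [/= hE _ _]; congr pair.
  by rewrite -[RHS]hE; apply/canon_eq; rewrite (eqv_relator Rr).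
rewrite /=; set s1 := nf_act (inl _, true) s.
have Vs1 : nf_valid s1 by apply: nf_act_valid.
set s2 := nf_act (inr j, true) s1.
have Vs2 : nf_valid s2 by apply: nf_act_valid.
rewrite {1}/nf_act [LHS](nf_act_shift Vs2 Ay) (nf_stableK (j, false)) //.
exact: (nf_actK (inl (sh (j, false) y), false)).
Qed.

Definition nf_base : state := (canon [::], [::]).

Lemma nf_base_valid : nf_valid nf_base.
Proof. by split; rewrite ?canon_id. Qed.

Lemma nf_eqv U V : eqv hnn_rel U V -> foldr nf_act nf_base U = foldr nf_act nf_base V.
Proof.
move=> UV; apply: (act_eqv (same := eq) (valid := nf_valid) _ _ _ _ _ UV nf_base_valid).
- exact: nf_act_valid.
- by move=> l s s' ->.
- exact: nf_actK.
- exact: nf_act_rel.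
Qed.

(** The base group embeds, because it acts freely on the heads of normal forms. *)
Lemma hnn_base_inj w v : eqv hnn_rel (inl_word w) (inl_word v) -> eqv relK w v.
Proof.
move/nf_eqv; rewrite !nf_act_inl ?/nf_base //=; try exact: nf_base_valid.
by case=> /canon_eq; rewrite !canonP !cats0.
Qed.

Lemma eqv_inl_word w v : eqv relK w v -> eqv hnn_rel (inl_word w) (inl_word v).
Proof.
have inl_wordE u : inl_word u = subst (fun y => [:: (inl y, false)]) u.
  by elim: u => //= -[y b] u ->; rewrite subst_cons /lsubst; case: b.
rewrite !inl_wordE; apply: eqv_subst => r Rr.
by rewrite -inl_wordE; apply/eqv_relator/hnn_rel_base.
Qed.

Definition syllables (l : seq (E * word TK)) : word L :=
  flatten [seq (inr p.1.1, p.1.2) :: inl_word p.2 | p <- l].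

(** Applied to the base state, a pinch-free word never cancels a stable letter:
    after e has acted, the head of the state lies in the subgroup associated to
    linv e, so that only the next syllable decides about cancellation. *)
Lemma pinch_free_act l : pinch_free l ->
  let: (h, M) := foldr nf_act nf_base (syllables l) in
  map fst M = map fst l /\ (if l is (e, _) :: _ then inA (linv e) h else True).
Proof.
elim: l => [|[e h] l IHl] //= [pf /IHl {IHl}].
rewrite /syllables /= -/(syllables l) foldr_cat.
have Vl := act_valid (f := nf_act) nf_act_valid (syllables l) nf_base_valid.
case: (foldr _ _ (syllables l)) Vl => h1 M Vl [Ml Ah1].
rewrite nf_act_inl //= {1}/nf_act /= -surjective_pairing /nf_stable /=.
rewrite ifF /=; last first.
  apply/negP => /andP[/asboolP]; rewrite canonP => Ah st.
  case: l M Ml Ah1 pf st {Vl} => [|[e2 h2] l] [|[e2' r2] M] //= [-> _] Ah1 pf /eqP e2E.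
  case: pf; first by rewrite e2E.
  by move: Ah1; rewrite e2E linvK => Ah1; rewrite (inA_mulr _ Ah1) in Ah.
rewrite Ml; split; first by case: (e).
by rewrite canonP; apply: phi_inA; apply: coset_repP.
Qed.

Lemma inl_word_cat w v : inl_word (w ++ v) = inl_word w ++ inl_word v.
Proof. exact: map_cat. Qed.

Lemma inr_shift e v : word_in (assoc e) v ->
  eqv hnn_rel ((inr e.1, e.2) :: inl_word v) (rcons (inl_word (shw e v)) (inr e.1, e.2)).
Proof.
case: e => j b /=.
have pos u : word_in (assoc (j, false)) u ->
    eqv hnn_rel ([:: (inr j, false)] ++ inl_word u)
      (inl_word (shw (j, false) u) ++ [:: (inr j, false)]).
  elim: u => //= -[y c] u IHu /andP[/= Ay /IHu {}IHu].
  suff E1 : eqv hnn_rel [:: (inr j, false); (inl y, c)]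
      [:: (inl (sh (j, false) y), c); (inr j, false)].
    rewrite -[X in eqv _ X _]/([:: (inr j, false); (inl y, c)] ++ inl_word u) E1.
    exact: (@eqv_cat _ hnn_rel _ _ (eqv_refl _ [:: (inl (sh (j, false) y), c)]) _ _ IHu).
  set y' := sh _ y; set x : L * bool := (inr j, false).
  have E0 : eqv hnn_rel ([:: x] ++ [:: (inl y, false)]) ([:: (inl y', false)] ++ [:: x]).
    by apply/eqv_divP; apply: (eqv_relator (hnn_rel_stable Ay)).
  case: c; last exact: E0.
  exact: eqv_conjV E0.
case: b => Av; rewrite -cats1 -cat1s; last exact: pos.
pose u := shw (j, true) v.
have Au : word_in (assoc (j, false)) u := shw_assoc Av.
have vE : shw (j, false) u = v.
  rewrite /u -map_comp; elim: v Av {u Au} => //= -[y c] v IHv /andP[/= Ay /IHv ->].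
  by have := shK Ay; rewrite /linv /= => ->.
pose x : word L := [:: (inr j, false)].
change (eqv hnn_rel (winv x ++ inl_word v) (inl_word u ++ winv x)).
apply: (@eqv_mulKl _ _ x); apply: (@eqv_mulKr _ _ _ _ x).
by rewrite -!catA eqv_Vmul cats0 catA eqv_mulV (pos u Au) vE.
Qed.

(** Every word is equal to a pinch-free one: a pinch that arises by adding a
    letter on the left is removed by the isomorphism [phi]. *)
Lemma nf_exists U : exists h l, pinch_free l /\ eqv hnn_rel U (inl_word h ++ syllables l).
Proof.
elim: U => [|[[y|j] b] U [h [l [pf UE]]]]; first by exists [::], [::].
  by exists ((y, b) :: h), l; split=> //; rewrite -cat1s UE.
set e := (j, b); case: (pselect (inA e h /\ starts (linv e) l)) => [[[v Av hv] st]|nst].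
  case: l st pf UE => // -[e1 h1] l /= /eqP -> [_ pf] UE.
  exists (shw e v ++ h1), l; split=> //.
  have sE : eqv hnn_rel ([:: (inr j, b)] ++ inl_word v) (inl_word (shw e v) ++ [:: (inr j, b)]).
    by rewrite cats1; apply: (inr_shift Av).
  rewrite -cat1s UE (eqv_inl_word hv) catA sE inl_word_cat -!catA.
  apply: eqv_cat => //.
  rewrite -[X in eqv _ X _]/([:: (inr j, b); linv (inr j, b)] ++ (inl_word h1 ++ syllables l)).
  by rewrite eqv_linvr.
exists [::], ((e, h) :: l); split; last first.
  by rewrite -cat1s UE.
by split=> // st Ah; apply: nst.
Qed.

(** Membership in a subgroup of the base group fails either inside the base
    group or because a normal form contains a stable letter (Britton). *)
Lemma not_mem_base (Z : pred TK) U :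
  ~ (exists2 h, word_in Z h & eqv hnn_rel U (inl_word h)) <->
  (exists h, eqv hnn_rel U (inl_word h) /\ ~ mem_sub relK Z h) \/
  (exists h l, [/\ l <> [::], pinch_free l & eqv hnn_rel U (inl_word h ++ syllables l)]).
Proof.
split=> [nZ|[[h [UE nZ]]|[h [l [l0 pf UE]]]] [h' Zh' UE']].
- have [h [l [pf UE]]] := nf_exists U.
  case: l pf UE => [|p l] pf UE; last by right; exists h, (p :: l).
  left; exists h; rewrite cats0 in UE; split=> // -[v Zv hv].
  by apply: nZ; exists v => //; rewrite UE; apply: eqv_inl_word.
- by apply: nZ; exists h' => //; apply: hnn_base_inj; rewrite -UE.
have := pinch_free_act pf; have := nf_eqv (eqv_trans (eqv_sym UE) UE').
have Vl := act_valid (f := nf_act) nf_act_valid (syllables l) nf_base_valid.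
rewrite foldr_cat; case: (foldr _ _ (syllables l)) Vl => h1 M Vl.
rewrite !nf_act_inl //; last exact: nf_base_valid.
by case=> _ -> []; case: l l0 {pf UE Vl}.
Qed.

(** The syllables that must lie outside an associated subgroup, as a computable
    list. *)
Definition pinches (l : seq (E * word TK)) : seq (E * word TK) :=
  (foldr (fun p acc => (p :: acc.1, if starts (linv p.1) acc.1 then p :: acc.2 else acc.2))
     ([::], [::]) l).2.

Lemma pinch_freeP l : pinch_free l <-> forall p, p \in pinches l -> ~ inA p.1 p.2.
Proof.
rewrite /pinches; set f := fun p acc => _.
have f1 s : (foldr f ([::], [::]) s).1 = s by elim: s => //= p s ->.
elim: l => [|[e h] l IHl] //=; rewrite IHl f1.
case: ifP => st; last by split=> [[]|H].
split=> [[nA H] p|H].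
  by rewrite inE => /predU1P[->|/H //]; apply: nA.
split; first by move=> _; apply: (H (e, h)); rewrite inE eqxx.
by move=> p pl; apply: H; rewrite inE pl orbT.
Qed.

Section Enumerate.
Variables (A : pred nat) (cTK : Coded TK) (cJ : Coded J).
Hypotheses (LTK : listable A TK) (LJ : listable A J).
Hypothesis re_relK : re A relK.
Hypothesis comp_assoc : computable A (fun p : E * TK => assoc p.1 p.2).
Hypothesis comp_sh : computable A (fun p : E * TK => sh p.1 p.2).
Hypothesis re_assoc : re A (fun p : E * word TK => ~ inA p.1 p.2).

Lemma comp_inl_word X {cX : Coded X} (f : X -> word TK) :
  computable A f -> computable A (fun x => inl_word (f x)).
Proof.
move=> Cf; apply: (comp_map (h := fun _ l => (inl l.1 : L, l.2))) => //.
apply: comp_pair; last by comp_proj.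
by apply: comp_inl; comp_proj.
Qed.

Lemma re_hnn_rel : re A hnn_rel.
Proof.
have LW : listable A (word TK) by apply: listable_seq; apply: listable_prod LTK (listable_bool A).
pose P1 (q : word L * word TK) := relK q.2 /\ q.1 == inl_word q.2.
pose stw (p : J * TK) : word L :=
  [:: (inr p.1, false); (inl p.2, false); (inr p.1, true); (inl (sh (p.1, false) p.2), true)].
pose P2 (q : word L * (J * TK)) := assoc (q.2.1, false) q.2.2 && (q.1 == stw q.2).
apply: (@re_ext _ _ _ _ (fun r => (exists w, P1 (r, w)) \/ exists p, P2 (r, p))); last first.
  move=> r; split=> [[w Rw|j y Ay]|[[w [Rw /eqP/= ->]]|[[j y] /andP[Ay /eqP/= ->]]]].
  - by left; exists w.
  - by right; exists (j, y); rewrite /P2 Ay /= eqxx.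
  - exact: hnn_rel_base.
  - exact: hnn_rel_stable.
apply: re_or.
  apply: (re_ex (P := P1) LW); apply: re_and; first by apply: (re_app re_relK); comp_proj.
  by apply: re_comp; apply: comp_eq; [|apply: comp_inl_word]; comp_proj.
apply: (re_ex (P := P2)); first exact: listable_prod.
have Cp : computable A (fun q : word L * (J * TK) => ((q.2.1, false), q.2.2)) by comp_proj.
apply: re_comp; apply: comp_andb; first exact: (comp1 comp_assoc Cp).
apply: comp_eq; first by comp_proj.
have Cx (b : bool) : computable A (fun q : word L * (J * TK) => (inr q.2.1 : L, b)).
  by apply: comp_pair; [apply: comp_inr|]; comp_proj.
have Cy (b : bool) (f : word L * (J * TK) -> TK) :
    computable A f -> computable A (fun q => (inl (f q) : L, b)).
  by move=> Cf; apply: comp_pair; [apply: comp_inl | comp_proj].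
rewrite /stw; apply: comp_cons; first exact: Cx.
apply: comp_cons; first by apply: Cy; comp_proj.
apply: comp_cons; first exact: Cx.
apply: comp_cons; last by comp_proj.
apply: Cy; exact: (comp1 comp_sh Cp).
Qed.

Lemma comp_pinches X {cX : Coded X} (f : X -> seq (E * word TK)) :
  computable A f -> computable A (fun x => pinches (f x)).
Proof.
move=> Cf; apply: comp_snd.
apply: (comp_foldr (h := fun _ p acc =>
  (p :: acc.1, if starts (linv p.1) acc.1 then p :: acc.2 else acc.2))) => //;
  last by comp_proj.
pose st := (X * ((E * word TK) * (seq (E * word TK) * seq (E * word TK))))%type.
apply: comp_pair; first by apply: comp_cons; comp_proj.
apply: comp_if; [|by apply: comp_cons; comp_proj | by comp_proj].
apply: (comp_seqcase (l := fun p : st => p.2.2.1) (g := fun=> false)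
  (h := fun p : st * ((E * word TK) * seq (E * word TK)) => p.2.1.1 == linv p.1.2.1.1)).
- by comp_proj.
- by comp_proj.
- by apply: comp_eq; [|apply: comp_linv]; comp_proj.
Qed.

Lemma comp_syllables X {cX : Coded X} (f : X -> seq (E * word TK)) :
  computable A f -> computable A (fun x => syllables (f x)).
Proof.
move=> Cf; apply: comp_flatten.
apply: (comp_map (h := fun _ p => (inr p.1.1 : L, p.1.2) :: inl_word p.2)) => //.
apply: comp_cons; last by apply: comp_inl_word; comp_proj.
by apply: comp_pair; [apply: comp_inr|]; comp_proj.
Qed.

(** The existence of a normal form as in [not_mem_base] is an existential
    statement about equality in the HNN extension and nonmembership in the
    subgroups of the base group. *)
Theorem re_not_mem_base (Z : pred TK) :
  re A (fun h => ~ mem_sub relK Z h) ->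
  re A (fun U => ~ (exists2 h, word_in Z h & eqv hnn_rel U (inl_word h))).
Proof.
move=> reZ.
have LW : listable A (word TK) by apply: listable_seq; apply: listable_prod LTK (listable_bool A).
have LE : listable A E by apply: listable_prod LJ (listable_bool A).
have reP : re A (fun p : word L * word L => eqv hnn_rel p.1 p.2).
  by apply: re_eqv re_hnn_rel; apply: listable_sum.
pose P1 (q : word L * word TK) := eqv hnn_rel q.1 (inl_word q.2) /\ ~ mem_sub relK Z q.2.
pose cert := (word TK * seq (E * word TK))%type.
pose P2 (q : word L * cert) := ~~ nilp q.2.2 /\
  ((forall p, p \in pinches q.2.2 -> ~ inA p.1 p.2) /\
   eqv hnn_rel q.1 (inl_word q.2.1 ++ syllables q.2.2)).
apply: (@re_ext _ _ _ _ (fun U => (exists h, P1 (U, h)) \/ exists c, P2 (U, c))); last first.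
  move=> U; rewrite not_mem_base; split=> -[H|H]; [by left | right | by left | right].
    case: H => h [l [l0 /pinch_freeP pf UE]]; exists (h, l); split=> //=.
    by case: (l) l0.
  case: H => -[h l] [/= l0 [/pinch_freeP pf UE]]; exists h, l; split=> //.
  by move=> lE; rewrite lE in l0.
apply: re_or.
  apply: (re_ex LW); apply: re_and; last by apply: (re_app reZ); comp_proj.
  apply: (re_app reP (f := fun q : word L * word TK => (q.1, inl_word q.2))).
  by apply: comp_pair; [|apply: comp_inl_word]; comp_proj.
apply: re_ex; first by apply: listable_prod => //; apply: listable_seq; apply: listable_prod.
apply: re_and; last apply: re_and.
- apply: re_comp; apply: comp_negb.
  apply: (comp_ext (g := fun q : word L * cert => if q.2.2 is _ :: _ then false else true)).
    apply: (comp_seqcase (l := fun q : word L * cert => q.2.2) (g := fun=> true)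
      (h := fun=> false)); by comp_proj.
  by move=> [U [h [|p l]]].
- apply: (re_all (P := fun q : (word L * cert) * (E * word TK) => ~ inA q.2.1 q.2.2)
    (l := fun q : word L * cert => pinches q.2.2)).
    by apply: (re_app re_assoc (f := fun q : (word L * cert) * (E * word TK) => q.2)); comp_proj.
  by apply: comp_pinches; comp_proj.
apply: (re_app reP (f := fun q : word L * cert => (q.1, inl_word q.2.1 ++ syllables q.2.2))).
apply: comp_pair; first by comp_proj.
by apply: comp_cat; [apply: comp_inl_word | apply: comp_syllables]; comp_proj.
Qed.
End Enumerate.
End HNN.

(** * Powers of a stable letter, and adjunction of a root *)

Section Powers.
Context {T : Type}.
Local Open Scope ring_scope.

(** The single element of unit serves as the letter x. *)
Definition xpow (k : int) : word (T + unit) := nseq `|k|%N (inr tt, k < 0).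

Lemma xpow_opp k : xpow (- k) = winv (xpow k).
Proof.
rewrite /xpow abszN winv_nseq /linv /=.
by case: k => [[|n]|n].
Qed.

Variable Rel : word (T + unit) -> Prop.

Lemma xpow_succ k : eqv Rel (xpow (k + 1)) (xpow k ++ [:: (inr tt, false)]).
Proof.
have nseqS n (l : (T + unit) * bool) : nseq n.+1 l = nseq n l ++ [:: l].
  by rewrite -[n.+1]addn1 nseqD.
case: k => n.
  have -> : Posz n + 1 = Posz n.+1 by lia.
  have -> : xpow (Posz n.+1) = nseq n.+1 (inr tt, false) by [].
  by rewrite nseqS.
have -> : Negz n + 1 = - Posz n by lia.
have -> : xpow (Negz n) = nseq n.+1 (inr tt, true) by [].
rewrite nseqS xpow_opp /xpow /= winv_nseq -catA.
rewrite -[X in eqv _ _ (_ ++ X)]/([:: linv (inr tt, false); (inr tt, false)]).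
by rewrite eqv_linvl cats0.
Qed.

Lemma xpowD i j : eqv Rel (xpow (i + j)) (xpow i ++ xpow j).
Proof.
elim: j => [|n IHn|n IHn].
- by rewrite addr0 cats0.
- have -> : i + n.+1%:Z = i + n%:Z + 1 by lia.
  have -> : n.+1%:Z = n%:Z + 1 :> int by lia.
  by rewrite !xpow_succ IHn -catA.
- apply: (@eqv_mulKr _ _ _ _ [:: (inr tt, false)]); rewrite -catA -!xpow_succ.
  have -> : i - n.+1%:Z + 1 = i - n%:Z by lia.
  by have -> : - n.+1%:Z + 1 = - n%:Z by lia.
Qed.

Lemma xpow_mulV k : eqv Rel (xpow k ++ xpow (- k)) [::].
Proof. by rewrite xpow_opp eqv_mulV. Qed.

Lemma xpow_Vmul k : eqv Rel (xpow (- k) ++ xpow k) [::].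
Proof. by rewrite xpow_opp eqv_Vmul. Qed.
End Powers.

Section Root.
Variables (T : countType) (Rel : word T -> Prop) (b : T) (alpha : nat).
Hypothesis alpha_gt0 : 0 < alpha.

Inductive root_rel : word (T + unit) -> Prop :=
| root_rel_base r : Rel r -> root_rel (inl_word unit r)
| root_rel_root : root_rel ((inl b, false) :: xpow (- Posz alpha)).

(** The wreath-like action of the group with a root x of b adjoined on alpha
    copies of the group: x moves each copy to the next one, and acts as b when
    it returns from the last copy to the first. *)
Definition root_act (l : (T + unit) * bool) (s : word T * nat) : word T * nat :=
  match l with
  | (inl c, e) => ((c, e) :: s.1, s.2)
  | (inr _, false) => if s.2.+1 < alpha then (s.1, s.2.+1) else ((b, false) :: s.1, 0)
  | (inr _, true) => if s.2 is i.+1 then (s.1, i) else ((b, true) :: s.1, alpha.-1)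
  end.

Local Notation valid := (fun s : word T * nat => s.2 < alpha).
Local Notation same := (fun s s' : word T * nat => eqv Rel s.1 s'.1 /\ s.2 = s'.2).

Lemma root_act_inl w s : foldr root_act s (inl_word unit w) = (w ++ s.1, s.2).
Proof. by elim: w => [|[c e] w /= ->] //; case: s. Qed.

Lemma root_act_pow k g i : i < alpha -> k <= alpha ->
  foldr root_act (g, i) (nseq k (inr tt, true)) =
  if k <= i then (g, i - k) else ((b, true) :: g, alpha + i - k).
Proof.
move=> ia; elim: k => [|k IHk] ka; first by rewrite subn0.
rewrite [nseq _ _]/= [foldr _ _ _]/= {}IHk ?(ltnW ka) //.
case: (leqP k i) => ki; rewrite /root_act /=.
  case E : (i - k) => [|m]; first by rewrite leqNgt (_ : i < k.+1) /=; [congr pair; lia | lia].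
  by rewrite (_ : k < i) /=; [congr pair; lia | lia].
case E : (alpha + i - k) => [|m]; first by lia.
by rewrite (_ : (k < i) = false) /=; [congr pair; lia | lia].
Qed.

Lemma root_act_eqv U V s : eqv root_rel U V -> s.2 < alpha ->
  same (foldr root_act s U) (foldr root_act s V).
Proof.
move=> UV Vs; apply: (act_eqv (same := same) (valid := valid) _ _ _ _ _ UV Vs).
- split=> [s1|s1 s2 [E1 E2]|s1 s2 s3 [E1 E2] [E3 E4]].
  + by split.
  + by split; [symmetry | rewrite E2].
  + by split; [rewrite E1 | rewrite E2].
- move=> [[c|[]] e] [g i] //=; case: e => /=; first by case: i => //= i; lia.
  by case: ifP.
- move=> [[c|[]] e] [g i] [g' i'] /= [gE ->]; first by split=> //; rewrite -cat1s gE.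
  case: e => /=; first by case: i' => //=; split=> //; rewrite -cat1s gE.
  by case: ifP => _ /=; split=> //; rewrite -cat1s gE.
- move=> [[c|[]] e] [g i] /= ia.
    by split=> //; rewrite -[X in eqv _ X _]/([:: (c, e); linv (c, e)] ++ g) eqv_linvr.
  case: e => /=.
    case: ifP => [//|/negbT]; rewrite -leqNgt => ai /=.
    split; last by lia.
    by rewrite -[X in eqv _ X _]/([:: (b, true); linv (b, true)] ++ g) eqv_linvr.
  case: i ia => [|i] ia /=; last by rewrite ia.
  rewrite (_ : (_ < _) = false) /=; last by lia.
  by split=> //; rewrite -[X in eqv _ X _]/([:: (b, false); linv (b, false)] ++ g) eqv_linvr.
- move=> r [g i] [] /=; first by move=> r' Rr' _; rewrite root_act_inl /= (eqv_relator Rr').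
  rewrite xpow_opp /xpow /= winv_nseq => ia.
  rewrite root_act_pow //= (_ : (alpha <= i) = false) /=; last by lia.
  split; last by lia.
  by rewrite -[X in eqv _ X _]/([:: (b, false); linv (b, false)] ++ g) eqv_linvr.
Qed.

(** The old letters act on the first component by left multiplication. *)
Lemma root_inj w v : eqv root_rel (inl_word unit w) (inl_word unit v) -> eqv Rel w v.
Proof.
move=> /(root_act_eqv (s := ([::], 0))) /(_ alpha_gt0) [].
by rewrite !root_act_inl /= !cats0.
Qed.

(** The orbit of the base point under the letters of S and x stays within S-words
    because crossing from the last copy to the first only multiplies by b. *)
Lemma root_mem (S : pred T) w U : S b ->
  word_in (fun y => if y is inl c then S c else true) U ->
  eqv root_rel (inl_word unit w) U -> mem_sub Rel S w.
Proof.
move=> Sb SU /(root_act_eqv (s := ([::], 0))) /(_ alpha_gt0) [].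
rewrite root_act_inl /= cats0 => wE _; exists (foldr root_act ([::], 0) U).1 => //.
elim: U SU {wE} => //= -[[c|[]] e] U IHU /andP[/= Sc /IHU].
  by rewrite /word_in /= Sc.
case: (foldr _ _ U) => g i /= Sg; case: e => /=; first by case: i => /=; rewrite ?Sb.
by case: ifP => /= _; rewrite ?Sb.
Qed.

Lemma root_pow : eqv root_rel [:: (inl b, false)] (xpow alpha).
Proof.
apply: (@eqv_mulKr _ _ _ _ (xpow (- Posz alpha))); rewrite xpow_mulV.
exact: (eqv_relator root_rel_root).
Qed.
End Root.

(** * Lifting words to the infinite cyclic cover *)

(** Letters (c, i) are indexed by levels i. The levels of the special letter v
    range from m to M, those of the other letters are unrestricted. *)
Section Levels.
Local Open Scope ring_scope.
Variables (T : countType) (r0 : word (T * int)) (v : T) (m M : int).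

Definition lev_assoc (e : unit * bool) : pred (T * int) := fun p =>
  (p.1 == v) ==> if e.2 then m < p.2 <= M else m <= p.2 < M.
Definition lev_sh (e : unit * bool) (p : T * int) : T * int :=
  (p.1, if e.2 then p.2 - 1 else p.2 + 1).
Local Notation hnn_rel := (hnn_rel (J := unit) (eq r0) lev_assoc lev_sh).
Local Notation inl_word := (inl_word unit).
Definition in_range : pred (T * int) := fun p => (p.1 == v) ==> (m <= p.2 <= M).

Lemma lev_sh_assoc e y : lev_assoc e y -> lev_assoc (linv e) (lev_sh e y).
Proof.
case: e y => [[] e] [c i]; rewrite /lev_assoc /lev_sh /=; case: eqP => //= _.
by case: e => /=; lia.
Qed.

Lemma lev_shK e y : lev_assoc e y -> lev_sh (linv e) (lev_sh e y) = y.
Proof.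
by case: e y => [[] e] [c i] _; rewrite /lev_sh /=; case: e => /=; congr pair; lia.
Qed.

Lemma lev_up c i : lev_assoc (tt, false) (c, i) ->
  eqv hnn_rel [:: (inr tt, false); (inl (c, i), false)]
    [:: (inl (c, i + 1), false); (inr tt, false)].
Proof.
move=> Ac; apply/eqv_divP.
exact: (eqv_relator (hnn_rel_stable _ _ Ac)).
Qed.

Hypotheses (m0 : m <= 0) (M0 : 0 <= M).

(** The letter (c, i) is the conjugate of (c, 0) by the i-th power of the
    stable letter whenever every (c, j) with j between 0 and i is available. *)
Lemma lev_conj c i : in_range (c, i) ->
  eqv hnn_rel (xpow i ++ [:: (inl (c, 0), false)]) ([:: (inl (c, i), false)] ++ xpow i).
Proof.
pose x : word (T * int + unit) := [:: (inr tt, false)].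
elim: i => [_|n IHn Rc|n IHn Rc]; first by rewrite cats0.
- have -> : n.+1%:Z = 1 + n%:Z :> int by lia.
  have gc : lev_assoc (tt, false) (c, Posz n).
    by move: Rc; rewrite /in_range /lev_assoc /=; case: eqP => //= _; lia.
  rewrite !xpowD -catA IHn; last by move: Rc; rewrite /in_range /=; case: eqP => //= _; lia.
  rewrite !catA; apply: eqv_cat => //.
  have := lev_up gc; rewrite addrC; exact.
- have E1 : - n.+1%:Z + 1 = - n%:Z by lia.
  have gc : lev_assoc (tt, false) (c, - n.+1%:Z).
    by move: Rc; rewrite /in_range /lev_assoc /=; case: eqP => //= _; lia.
  apply: (@eqv_mulKl _ _ (xpow 1)); rewrite !catA.
  have -> : eqv hnn_rel (xpow 1 ++ xpow (- n.+1%:Z)) (xpow (- n%:Z)).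
    by rewrite -xpowD -E1 addrC.
  rewrite IHn; last by move: Rc; rewrite /in_range /=; case: eqP => //= _; lia.
  have := lev_up gc; rewrite E1 -[X in eqv _ X _]/(xpow 1 ++ [:: (inl (c, - n.+1%:Z), false)]) => ->.
  rewrite -[X in eqv _ _ X]/([:: (inl (c, - n%:Z), false)] ++ (xpow 1 ++ xpow (- n.+1%:Z))).
  by rewrite -xpowD -E1 addrC.
Qed.
End Levels.

Section Lift.
Local Open Scope ring_scope.
Variables (T : countType) (b : T) (w : T -> int) (alpha : nat).
Hypothesis w_b : w b = Posz alpha.

Definition lweight (l : T * bool) : int := if l.2 then - w l.1 else w l.1.
Definition wsum (W : word T) : int := foldr (fun l i => lweight l + i) 0 W.

Lemma wsum_cat U V : wsum (U ++ V) = wsum U + wsum V.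
Proof. by elim: U => [|l U IHU] /=; rewrite ?add0r // IHU addrA. Qed.

(** The letter of T read from level i, respectively its inverse, lifts to an edge
    whose starting level is i, respectively i - w a. *)
Definition lift_level (i : int) (l : T * bool) : int := if l.2 then i - w l.1 else i.

(** The letter a, read from level j to level j + w a, lifts to (a, j).  Only b
    lifts to the empty word: it will be a power of a letter x of weight 1, whose
    lifts form a maximal tree of the cover. *)
Fixpoint lift_word (i : int) (W : word T) : word (T * int) :=
  if W is l :: W' then
    (if l.1 == b then [::] else [:: ((l.1, lift_level i l), l.2)]) ++ lift_word (i + lweight l) W'
  else [::].

Lemma lift_word_cat i U V : lift_word i (U ++ V) = lift_word i U ++ lift_word (i + wsum U) V.
Proof.
elim: U i => [|l U IHU] i /=; first by rewrite addr0.
by rewrite IHU addrA catA.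
Qed.

Lemma size_lift_word i W : (size (lift_word i W) + count (fun l => l.1 == b) W = size W)%N.
Proof.
elim: W i => //= l W IHW i; rewrite size_cat -(IHW (i + lweight l)).
by case: (l.1 == b); rewrite /= ?add0n ?add1n ?addnS ?addSn.
Qed.

(** In the group with the root x of b adjoined, (c, j) is the conjugate by
    the j-th power of x of c divided by its weight. *)
Definition sigma0 (p : T * int) : word (T + unit) :=
  xpow p.2 ++ (inl p.1, false) :: xpow (- w p.1) ++ xpow (- p.2).

Section Sigma.
Variable Rel : word T -> Prop.
Local Notation root_rel := (root_rel Rel b alpha).
Local Notation inl_word := (inl_word unit).

Lemma root_letter e : eqv root_rel [:: (inl b, e)] (xpow (lweight (b, e))).
Proof.
rewrite /lweight /= w_b; case: e; last exact: root_pow.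
by rewrite xpow_opp -(root_pow Rel b alpha).
Qed.

(** The lift of W is the conjugate by x ^ i of W divided by its weight. *)
Lemma sigma_lift_word i W :
  eqv root_rel (subst sigma0 (lift_word i W) ++ xpow (i + wsum W)) (xpow i ++ inl_word W).
Proof.
elim: W i => [|[c e] W IHW] i /=; first by rewrite addr0 cats0.
rewrite subst_cat -catA addrA IHW -[X in eqv _ _ (_ ++ X)]cat1s.
case: eqP => [->|_]; first by rewrite root_letter xpowD -catA.
rewrite subst1 /lsubst /lift_level /lweight /sigma0; case: e => /=.
  rewrite winv_cat winv_cons !winv_cat -!xpow_opp !opprK -cats1 -!catA.
  rewrite [xpow (- (i - w c)) ++ _]catA xpow_Vmul.
  by rewrite [xpow (i - w c) ++ _]catA -xpowD subrK.
rewrite -cat1s -!catA (xpowD _ i (w c)) -[(xpow i ++ _) ++ _]catA.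
by rewrite [xpow (- i) ++ _]catA (xpow_Vmul _ i) cat0s [xpow (- w c) ++ _]catA (xpow_Vmul _ (w c)).
Qed.

Lemma sigma_relator i W : Rel W -> wsum W = 0 -> eqv root_rel (subst sigma0 (lift_word i W)) [::].
Proof.
move=> RW W0; apply: (@eqv_mulKr _ _ _ _ (xpow i)).
have := sigma_lift_word i W; rewrite W0 addr0 => ->.
by rewrite (eqv_relator (root_rel_base _ _ RW)) cats0.
Qed.
End Sigma.

Section Stable.
Variables (r0 : word (T * int)) (v : T) (m M : int).
Local Notation hnn_rel := (hnn_rel (J := unit) (eq r0) (lev_assoc v m M) (@lev_sh T)).
Local Notation inl_word := (inl_word unit).

(** The power of x carries the weight of c, and (c, 0) has weight 0. *)
Definition embed (c : T) : word (T * int + unit) :=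
  (if c == b then [::] else [:: (inl (c, 0), false)]) ++ xpow (w c).

(** The homomorphism from the HNN extension back to the group with a root. *)
Definition sigma (y : T * int + unit) : word (T + unit) :=
  match y with inl p => sigma0 p | inr _ => xpow 1 end.

Lemma sigma_inl_word W : subst sigma (inl_word W) = subst sigma0 W.
Proof. by elim: W => //= l W IHW; rewrite !subst_cons IHW. Qed.

Lemma sigma_xpow k : subst sigma (xpow k) = xpow k.
Proof.
by rewrite /xpow; elim: `|k|%N => //= n IHn; rewrite subst_cons IHn; case: (k < 0).
Qed.

(** Hence the map to the HNN extension is injective, by [root_inj]. *)
Lemma sigma_embed Rel W :
  eqv (root_rel Rel b alpha) (subst sigma (subst embed W)) (inl_word W).
Proof.
have letter c : eqv (root_rel Rel b alpha) (subst sigma (embed c)) [:: (inl c, false)].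
  rewrite /embed subst_cat sigma_xpow; case: eqP => [->|_].
    by have := root_letter Rel false; rewrite /lweight /= => <-.
  have xs0 : xpow 0 = [::] :> word (T + unit) by [].
  rewrite subst1 /lsubst /= /sigma0 /= oppr0 xs0 cats0 -cat1s.
  by rewrite xpow_Vmul.
elim: W => // -[c e] W IHW; rewrite subst_cons subst_cat IHW.
rewrite -[X in eqv _ _ X]/([:: (inl c, e)] ++ inl_word W); apply: eqv_cat => //.
by rewrite /lsubst; case: e; rewrite /= ?subst_winv letter.
Qed.

Lemma sigma_hnn_rel Rel r i0 R : Rel r -> wsum r = 0 -> r0 = lift_word i0 r -> hnn_rel R ->
  eqv (root_rel Rel b alpha) (subst sigma R) [::].
Proof.
move=> Rr r_0 r0E; case=> {R} [_ <-|[] [c i] _].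
  by rewrite sigma_inl_word r0E; apply: sigma_relator.
have -> : subst sigma [:: (inr tt, false); (inl (c, i), false); (inr tt, true);
    (inl (lev_sh (tt, false) (c, i)), true)] =
    (xpow 1 ++ sigma0 (c, i) ++ xpow (- 1)) ++ winv (sigma0 (c, i + 1)).
  by rewrite !subst_cons /= cats0 -!catA xpow_opp.
have sE j : sigma0 (c, j) = xpow j ++ (((inl c, false) :: xpow (- w c)) ++ xpow (- j)) by [].
apply/eqv_divP; rewrite !sE; set B := _ :: _.
have -> : i + 1 = 1 + i by lia.
have -> : - (1 + i) = - i + - 1 by lia.
by rewrite (xpowD _ 1 i) (xpowD _ (- i) (- 1)) -!catA.
Qed.
Hypotheses (m0 : m <= 0) (M0 : 0 <= M).

(** In the HNN extension the lift of W is also the conjugate by x ^ i of the image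
    of W divided by its weight, as far as the levels of v stay within the range. *)
Lemma embed_lift_word i W : word_in (in_range v m M) (lift_word i W) ->
  eqv hnn_rel (xpow i ++ subst embed W) (inl_word (lift_word i W) ++ xpow (i + wsum W)).
Proof.
elim: W i => [|[c e] W IHW] i /=; first by rewrite addr0 cats0.
rewrite word_in_cat => /andP[Rc /IHW {}IHW].
rewrite subst_cons inl_word_cat addrA -catA -IHW {IHW} xpowD !catA.
apply: eqv_cat => //; rewrite /lsubst /lift_level /lweight /embed /=.
move: Rc; case: eqP => [->|_] Rc /=; first by case: e {Rc}; rewrite -?xpow_opp.
case: e Rc => /=; rewrite /word_in /= andbT => Rc.
  rewrite winv_cons -cats1 -xpow_opp catA -[X in eqv _ _ X]cat1s -(xpowD hnn_rel).
  exact: eqv_conjV (lev_conj r0 m0 M0 Rc).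
by rewrite -cat1s catA (lev_conj r0 m0 M0 Rc) -catA.
Qed.

End Stable.
End Lift.

(** * Lifts of reduced words *)

Section LiftReduced.
Local Open Scope ring_scope.
Variables (T : countType) (b : T) (w : T -> int) (alpha : nat).
Hypothesis alpha_gt0 : (0 < alpha)%N.
Hypothesis w_b : w b = Posz alpha.
Local Notation lift_word := (lift_word b w).

(** The first letter of the lift comes from the first letter of W other than b;
    the run of letters b before it shifts the level by multiples of alpha. *)
Lemma lift_word_head W i c j e L : reduced W -> lift_word i W = ((c, j), e) :: L ->
  exists n s W', W = nseq n (b, s) ++ (c, e) :: W' /\
    j = lift_level w (i + (if s then - (alpha * n)%N%:Z else (alpha * n)%N%:Z)) (c, e).
Proof.
elim: W i => //= -[c0 e0] W IHW i red /=; case: eqP => [c0b|_] /=; last first.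
  by case=> -> <- -> _; exists 0%N, false, W; rewrite muln0 addr0.
subst c0; move=> /IHW[]; first exact: path_sorted red.
move=> n [s [W' [WE jE]]]; subst W.
have [n0|n_gt0] := posnP n; last have s_e : s = e0.
- exists 1%N, e0, W'; rewrite n0 muln1; split=> //; rewrite jE n0 muln0 /lweight /= w_b.
  by case: (s); case: (e0); rewrite ?oppr0 !addr0.
- case: n n_gt0 red {jE IHW} => //= n _ /andP[/eqP neq _].
  by case: (s) (e0) neq => [] [].
exists n.+1, e0, W'; split; first by rewrite s_e.
rewrite jE s_e /lweight /= w_b; congr lift_level; case: (e0); lia.
Qed.

(** If two inverse letters meet in the lift, then the letters b between their
    originals have total weight 0; in a reduced word there are none. *)
Lemma lift_word_reduced W i : reduced W -> reduced (lift_word i W).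
Proof.
elim: W i => // -[c e] W IHW i red; rewrite [lift_word i _]/=.
have redW : reduced W by apply: path_sorted red.
case: eqP => [_|_]; first exact: IHW.
rewrite cat1s reduced_cons IHW //=.
case E : (lift_word _ _) => [|[[c' j] e'] L] //; apply/eqP => -[c'E jE e'E]; subst c' e'.
have [n [s [W' [WE]]]] := lift_word_head redW E.
rewrite jE /lift_level /lweight /= => levE.
have n0 : n = 0%N by case: (e) levE; case: (s) => /=; nia.
by move: red; rewrite WE n0 reduced_cons /= /linv eqxx andbF.
Qed.

(** If b carries all the weight, then a run of letters b is the only way to change
    the level, and two visits to level 0 exclude nonempty runs between them. *)
Lemma lift_word_level0 W l i : (forall c, c != b -> w c = 0) -> alpha = 1%N -> l.1 != b ->
  reduced (rcons W l) -> (forall p, p \in lift_word i (rcons W l) -> p.1.2 = 0) ->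
  exists n s Z, [/\ rcons W l = nseq n (b, s) ++ Z, all (fun l' => l'.1 != b) Z &
    i = (if s then n%:Z else - n%:Z)].
Proof.
move=> w0 alpha1 lb; elim: W i => [|[c e] W IHW] i.
  move=> _; rewrite /= (negbTE lb) => /(_ _ (mem_head _ _)) /=.
  rewrite /lift_level w0 // subr0 if_same => ->.
  by exists 0%N, false, [:: l]; rewrite /= lb oppr0.
move=> red lev; have redW : reduced (rcons W l) by apply: path_sorted red.
have [cb|cb] := eqVneq c b; last first.
  move: lev; rewrite /= (negbTE cb) => lev.
  have i0 : i = 0.
    by have := lev _ (mem_head _ _); rewrite /lift_level /= w0 // subr0 if_same.
  have [|n [s [Z [E bZ iE]]]] := IHW (i + lweight w (c, e)) redW.
    by move=> p pl; apply: lev; rewrite inE pl orbT.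
  exists 0%N, false, ((c, e) :: Z); rewrite /= cb bZ i0 oppr0; split=> //.
  have n0 : n = 0%N by move: iE; rewrite i0 /lweight /= w0 // oppr0 if_same; case: (s); lia.
  by rewrite E n0.
subst c; move: lev; rewrite /= eqxx /= => lev.
have [n [s [Z [E bZ]]]] := IHW _ redW lev; rewrite /lweight /= w_b alpha1 => iE.
have [n0|n_gt0] := posnP n.
  by exists 1%N, e, Z; rewrite /= E n0; split=> //; move: iE; rewrite n0; case: (e); case: (s); lia.
have se : s = e.
  move: red; rewrite rcons_cons E; case: n n_gt0 {E iE} => // n _ /andP[/eqP neq _].
  by case: (s) (e) neq => [] [].
exists n.+1, e, Z; split=> //; first by rewrite /= E se.
by move: iE; rewrite se; case: (e); lia.
Qed.
End LiftReduced.

(** * The inductive step *)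

(** For words other than the empty one, r ++ r is reduced if and only if r is
    reduced and its last and first letters are not inverse to each other. *)
Definition cyc_reduced (T : eqType) (r : word T) := reduced (r ++ r).

(** The Freiheitssatz for a cyclically reduced relator r: the letters other than
    a letter u of r are free generators of a subgroup. *)
Definition freiheit (T : eqType) (r : word T) :=
  forall u V, u \in map fst r -> word_in (predC1 u) V ->
  eqv (eq r) V [::] -> eqv no_rel V [::].

(** The half of decidability that needs an argument; the subgroup itself is
    enumerable in any group with enumerable relators. *)
Definition co_enumerable (T : countType) {cT : Coded T} (r : word T) :=
  forall A (S : pred T), listable A T -> computable A S ->
  re A (fun W => ~ mem_sub (eq r) S W).

Lemma bounded_levels (s : seq int) (i : int) : i \in s ->
  exists m M : int, [/\ m \in s, M \in s & forall j, j \in s -> (m <= j <= M)%R].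
Proof.
elim: s i => // a s IHs i _; case: s IHs => [|a' s] IHs.
  by exists a, a; rewrite inE eqxx; split=> // j; rewrite inE => /eqP->; rewrite lexx.
have [m [M [ms Ms mM]]] := IHs a' (mem_head _ _).
have mM' := mM _ ms.
exists (if (a < m)%R then a else m), (if (M < a)%R then a else M); split.
- by rewrite inE; case: ifP; rewrite ?eqxx ?ms ?orbT.
- by rewrite inE; case: ifP; rewrite ?eqxx ?Ms ?orbT.
- move=> j; rewrite inE => /predU1P[->|/mM]; case: ifP; case: ifP; lia.
Qed.

Lemma wsum_eqv (T : countType) (w : T -> int) (Rel : word T -> Prop) W V :
  (forall r, Rel r -> wsum w r = 0%R) -> eqv Rel W V -> wsum w W = wsum w V.
Proof.
move=> R0; elim=> {W V} // [W V U _ -> _ //|U V a e|U V r Rr].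
  by rewrite !wsum_cat /= /lweight /=; case: e => /=; lia.
by rewrite !wsum_cat (R0 _ Rr) add0r.
Qed.

Section Step.
Local Open Scope ring_scope.
Variables (T : countType) (cT : Coded T) (r : word T) (b v : T) (w : T -> int) (alpha : nat).
Hypothesis alpha_gt0 : (0 < alpha)%N.
Hypothesis w_b : w b = Posz alpha.
Hypothesis v_b : v != b.
Hypothesis r_b : b \in map fst r.
Hypothesis r_v : v \in map fst r.
Hypothesis r_cyc : cyc_reduced r.
Hypothesis r_w : wsum w r = 0.
(* In the applications at most two weights differ from zero. *)
Hypothesis comp_w : forall A, computable A (fun c => xpow (w c) : word (T * int + unit)).
Hypothesis IH : forall r0 : word (T * int), (size r0 < size r)%N -> cyc_reduced r0 ->
  freiheit r0 /\ co_enumerable r0.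

(** The starting level is chosen so that (v, 0) occurs; thereby the level 0 of
    the image of v under [embed] is within range. *)
Lemma special_level : exists i0, (v, 0) \in map fst (lift_word b w i0 r).
Proof.
move: r_v => /mapP[[v' e] + /= vE]; rewrite -{}vE => /splitPr vr; case: vr => p q.
exists (- wsum w p + (if e then w v else 0)); rewrite lift_word_cat map_cat mem_cat /=.
rewrite (negbTE v_b) /= inE; apply/orP; right; apply/orP; left.
by rewrite /lift_level /=; apply/eqP; congr pair; case: e; lia.
Qed.

Lemma level_data : exists i0 m M, let r0 := lift_word b w i0 r in
  [/\ (v, 0) \in map fst r0, (v, m) \in map fst r0, (v, M) \in map fst r0
    & word_in (in_range v m M) r0] /\ m <= 0 <= M.
Proof.
have [i0 v0] := special_level; exists i0; set r0 := lift_word b w i0 r in v0 *.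
pose s := [seq p.2 | p <- map fst r0 & p.1 == v].
have sP j : (j \in s) = ((v, j) \in map fst r0).
  apply/mapP/idP => [[[c i]]|vj]; last by exists (v, j); rewrite // mem_filter eqxx.
  by rewrite mem_filter => /andP[/eqP /= -> ci ->].
have [m [M [ms Ms mM]]] : exists m M : int,
    [/\ m \in s, M \in s & forall j, j \in s -> m <= j <= M].
  by apply: (bounded_levels (i := 0)); rewrite sP.
exists m, M; rewrite /= -/r0 -!sP ms Ms sP; split; last by apply: mM; rewrite sP.
split=> //; apply/allP => -[[c i] e] /(map_f fst) ci; apply/implyP => /= /eqP cv.
by apply: mM; rewrite sP -cv.
Qed.

Lemma step_size i0 : (size (lift_word b w i0 r) < size r)%N.
Proof.
rewrite -[X in (_ < X)%N](size_lift_word b w i0) -[X in (X < _)%N]addn0 ltn_add2l -has_count.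
by move: r_b => /mapP[l lr lb]; apply/hasP; exists l => //; rewrite lb.
Qed.

(** As r has weight 0, the lift of r ++ r is the lift of r taken twice. *)
Lemma step_cyc i0 : cyc_reduced (lift_word b w i0 r).
Proof.
rewrite /cyc_reduced -{2}[i0]addr0 -r_w -lift_word_cat.
exact: lift_word_reduced alpha_gt0 w_b _ _ r_cyc.
Qed.

Section Base.
Variables (i0 m M : int).
Local Notation r0 := (lift_word b w i0 r).
Hypothesis r0_0 : (v, 0) \in map fst r0.
Hypothesis r0_m : (v, m) \in map fst r0.
Hypothesis r0_M : (v, M) \in map fst r0.
Hypothesis r0_range : word_in (in_range v m M) r0.
Hypothesis mM : m <= 0 <= M.

Local Notation assoc := (lev_assoc v m M).
Local Notation sh := (@lev_sh T).
Local Notation hnn_rel := (hnn_rel (J := unit) (eq r0) assoc sh).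
Local Notation inl_word := (inl_word unit).
Local Notation embed := (embed b w).
Local Notation f := (subst embed).
Local Notation sigma := (sigma w).

Let m0 : m <= 0. Proof. by case/andP: mM. Qed.
Let M0 : 0 <= M. Proof. by case/andP: mM. Qed.
Let r0_free : freiheit r0 := (IH (step_size i0) (step_cyc i0)).1.

(** Each associated subgroup misses one of the extreme letters (v, m), (v, M) of
    r0, so it is free by the Freiheitssatz for r0, and shifting the levels
    respects equality. *)
Lemma lev_sh_triv (e : unit * bool) W :
  word_in (assoc e) W -> eqv (eq r0) W [::] ->
  eqv (eq r0) (map (fun l => (sh e l.1, l.2)) W) [::].
Proof.
move=> AW W1; apply: eqv_free.
have W1' : eqv no_rel W [::].
  apply: (r0_free (u := (v, if e.2 then m else M))) W1; first by case: ifP.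
  apply: sub_all AW => -[[c i] e'] /=; rewrite /lev_assoc /=; case: e.2.
    by case: eqP => /= [_ H|cv _]; apply/eqP => -[]; [lia | move=> /cv].
  by case: eqP => /= [_ H|cv _]; apply/eqP => -[]; [lia | move=> /cv].
have shE U : map (fun l => (sh e l.1, l.2)) U = subst (fun p => [:: (sh e p, false)]) U.
  by elim: U => //= -[p c] U ->; rewrite subst_cons /lsubst; case: c.
by rewrite shE; apply: (eqv_subst (v := [::]) _ W1').
Qed.

Local Notation sh_assoc := (@lev_sh_assoc T v m M).
Local Notation shK := (@lev_shK T v m M).

Lemma base_inj W V : eqv hnn_rel (inl_word W) (inl_word V) -> eqv (eq r0) W V.
Proof. exact: (hnn_base_inj sh_assoc shK lev_sh_triv). Qed.

Lemma embed_relator : eqv hnn_rel (f r) [::].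
Proof.
apply: (@eqv_mulKl _ _ (xpow i0)); rewrite cats0.
rewrite (embed_lift_word r0 m0 M0) // r_w addr0.
by rewrite (eqv_relator (hnn_rel_base _ _ (erefl r0))).
Qed.

Lemma embed_eqv W V : eqv (eq r) W V -> eqv hnn_rel (f W) (f V).
Proof. by apply: eqv_subst => _ <-; apply: embed_relator. Qed.

Lemma embed_avoid V : word_in (predC1 v) V ->
  eqv hnn_rel (f V) (inl_word (lift_word b w 0 V) ++ xpow (wsum w V)).
Proof.
move=> vV; rewrite -[wsum w V]add0r -(embed_lift_word r0 m0 M0) //.
elim: V 0 vV => //= -[c e] V IHV i /andP[/= cv /IHV {}IHV].
rewrite word_in_cat IHV andbT; case: (c == b) => //.
by rewrite /word_in /= /in_range /= (negbTE cv).
Qed.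

Lemma sigma_eqv U V : eqv hnn_rel U V ->
  eqv (root_rel (eq r) b alpha) (subst sigma U) (subst sigma V).
Proof.
by apply: eqv_subst => R relR; apply: (sigma_hnn_rel w_b (erefl r) r_w (erefl r0) relR).
Qed.

(** A trivial word avoiding v lifts to a trivial word of the base group,
    which avoids (v, 0), hence is freely trivial. *)
Lemma step_free_special V : word_in (predC1 v) V -> eqv (eq r) V [::] -> eqv no_rel V [::].
Proof.
move=> vV V1; have V0 : wsum w V = 0.
  by rewrite (wsum_eqv (V := [::]) _ V1) // => _ <-.
have lamV : eqv no_rel (lift_word b w 0 V) [::].
  apply: (r0_free r0_0).
    move: vV (X in lift_word _ _ X) {V1 V0}; elim: V => //= -[c e] V IHV /andP[/= cv /IHV {}IHV] i.
    rewrite word_in_cat IHV andbT; case: (c == b) => //.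
    by rewrite /word_in /= andbT; apply: contra cv => /eqP[->].
  apply: base_inj; rewrite -[X in eqv _ _ X](embed_eqv V1) embed_avoid // V0.
  by rewrite cats0.
apply: (root_inj alpha_gt0 (b := b)).
have := sigma_lift_word w_b no_rel 0 V; rewrite V0 -[xpow 0 ++ _]/(inl_word V) => <-.
rewrite -[inl_word [::]]/(subst (sigma0 w) [::]) cats0.
exact: (eqv_subst (v := [::]) _ lamV).
Qed.

(** When the letters of S have weight 0, lifting an S-word only decorates its
    letters with the level 0. *)
Section Level0.
Variable S : pred T.
Hypothesis S_b : ~~ S b.
Hypothesis S_w : forall c, S c -> w c = 0.

Lemma embed_level0 V : word_in S V ->
  f V = inl_word (map (fun l => ((l.1, 0), l.2)) V).
Proof.
elim: V => //= -[c e] V IHV /andP[/= Sc /IHV E].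
have cb : (c == b) = false by apply/eqP => cb; move: S_b; rewrite -cb Sc.
by rewrite subst_cons E /lsubst /embed S_w //= cb; case: e.
Qed.

Lemma sigma0_level0 V : word_in (fun p => S p.1 && (p.2 == 0)) V ->
  subst (sigma0 w) V = inl_word (map (fun l => (l.1.1, l.2)) V).
Proof.
elim: V => //= -[[c i] e] V IHV /andP[/= /andP[Sc /eqP ->] /IHV E].
by rewrite subst_cons E /lsubst /sigma0 /= S_w //; case: e.
Qed.

Lemma mem_sub_level0 W : mem_sub (eq r) S W <->
  exists2 h, word_in (fun p => S p.1 && (p.2 == 0)) h & eqv hnn_rel (f W) (inl_word h).
Proof.
split=> [[V SV WV]|[h Sh WE]].
  exists (map (fun l => ((l.1, 0), l.2)) V).
    by rewrite /word_in all_map; apply: sub_all SV => l /= ->.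
  by rewrite -embed_level0 //; apply: embed_eqv.
exists (map (fun l => (l.1.1, l.2)) h).
  by rewrite /word_in all_map; apply: sub_all Sh => l /= /andP[].
apply: (root_inj alpha_gt0 (b := b)); rewrite -sigma0_level0 //.
rewrite -(sigma_inl_word w) -(sigma_eqv WE).
by symmetry; apply: sigma_embed.
Qed.

Lemma step_free_level0 c i V : (c, i) \in map fst r0 -> i <> 0 ->
  word_in S V -> eqv (eq r) V [::] -> eqv no_rel V [::].
Proof.
move=> ci i0' SV V1; pose V0 : word (T * int) := map (fun l => ((l.1, 0), l.2)) V.
have : eqv no_rel V0 [::].
  apply: (r0_free ci).
    by rewrite /word_in all_map; apply/allP => l _; apply/eqP => -[_ /esym].
  apply: base_inj; rewrite -[X in eqv _ _ X](embed_eqv V1) -embed_level0 //.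
move/(@eqv_subst _ _ (fun p => [:: (p.1, false)]) no_rel no_rel) => H.
suff <- : subst (fun p : T * int => [:: (p.1, false)]) V0 = V by apply: H.
rewrite /V0; elim: (V) => //= -[a e] U IHU; rewrite subst_cons IHU /lsubst.
by case: e.
Qed.
End Level0.

Definition is_stable (l : (T * int + unit) * bool) := if l.1 is inr _ then true else false.
(** The weight of W, computed as the product of the stable letters in its image,
    is divided out; what remains is in the kernel of the weight. *)
Definition strip W := f W ++ winv (filter is_stable (f W)).

Lemma filter_stable W : eqv hnn_rel (filter is_stable (f W)) (xpow (wsum w W)).
Proof.
have xsE k : filter is_stable (xpow k) = xpow k.
  by rewrite /xpow; elim: `|k|%N => //= n ->.
elim: W => // -[c e] W IHW; rewrite subst_cons filter_cat IHW /=.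
rewrite xpowD; apply: eqv_cat => //.
rewrite /lsubst /embed /lweight /=; case: e; case: (c == b); rewrite /= ?winv_cons ?xsE //.
- by rewrite -xpow_opp xsE.
- by rewrite filter_rcons /= -xpow_opp xsE.
Qed.

(** When S contains b, the subgroup generated by S and x meets the given group
    in the subgroup generated by S. *)
Lemma mem_sub_strip (S : pred T) W : S b -> ~~ S v -> mem_sub (eq r) S W <->
  exists2 h, word_in (fun p => S p.1 && (p.1 != b)) h & eqv hnn_rel (strip W) (inl_word h).
Proof.
move=> Sb Sv; rewrite /strip; split=> [[V SV WV]|[h Sh WE]].
  exists (lift_word b w 0 V).
    move: (X in lift_word _ _ X); elim: V SV {WV} => //= -[c e] V IHV /andP[/= Sc /IHV {}IHV] i.
    rewrite word_in_cat IHV andbT; case: (eqVneq c b) => //= cb.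
    by rewrite /word_in /= Sc cb.
  have Vv : word_in (predC1 v) V.
    by apply: sub_all SV => l /=; apply: contraTneq => ->.
  have wE : wsum w W = wsum w V by apply: wsum_eqv WV => _ <-.
  by rewrite filter_stable (embed_eqv WV) embed_avoid // wE -catA eqv_mulV cats0.
have {}WE : eqv hnn_rel (f W) (inl_word h ++ filter is_stable (f W)).
  by rewrite -WE -catA eqv_Vmul cats0.
apply: (root_mem alpha_gt0 Sb (U := subst sigma (inl_word h ++ filter is_stable (f W)))); last first.
  by rewrite -(sigma_eqv WE); symmetry; apply: sigma_embed.
pose Sx (y : T + unit) := if y is inl c then S c else true.
have Sx_xs k : word_in Sx (xpow k) by rewrite /xpow; elim: `|k|%N.
apply: (@word_in_subst _ _ _ (fun y => if y is inl p then S p.1 else true)).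
  case=> [[c i]|u] //= Sc; rewrite /sigma0 word_in_cat Sx_xs /= Sc.
  by rewrite word_in_cat !Sx_xs.
rewrite word_in_cat; apply/andP; split.
  by rewrite /word_in all_map; apply: sub_all Sh => l /= /andP[].
by apply/allP => -[[p|u] e]; rewrite mem_filter.
Qed.

Section Enumerate.
Variable A : pred nat.
Hypothesis LT : listable A T.
Local Notation computable := (computable A).
Let LTZ : listable A (T * int). Proof. exact: listable_prod LT (listable_int A). Qed.

Lemma comp_lev_assoc : computable (fun p : (unit * bool) * (T * int) => assoc p.1 p.2).
Proof.
apply: comp_implyb; first by apply: comp_eq; comp_proj.
apply: comp_if; first by comp_proj.
  have lt_add1 (i : int) : (m < i <= M) = (m + 1 <= i < M + 1) by lia.
  apply: comp_ext (fun p => lt_add1 p.2.2); apply: comp_int_range; by comp_proj.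
by apply: comp_int_range; comp_proj.
Qed.

Lemma comp_lev_sh : computable (fun p : (unit * bool) * (T * int) => sh p.1 p.2).
Proof.
apply: comp_pair; first by comp_proj.
apply: comp_if; [by comp_proj | apply: comp_int_pred | apply: comp_int_succ]; by comp_proj.
Qed.

Lemma re_lev_assoc :
  re A (fun p : (unit * bool) * word (T * int) => ~ mem_sub (eq r0) (assoc p.1) p.2).
Proof.
have [_ co] := IH (step_size i0) (step_cyc i0).
have side e : re A (fun p : (unit * bool) * word (T * int) =>
    (p.1.2 == e) /\ ~ mem_sub (eq r0) (assoc (tt, e)) p.2).
  apply: re_and; first by apply: re_comp; apply: comp_eq; comp_proj.
  apply: (re_app (co A _ LTZ _)); last by comp_proj.
  apply: (comp1 comp_lev_assoc (f := fun p => ((tt, e), p))); by comp_proj.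
apply: (re_ext (re_or (side false) (side true))) => -[[[] e] W] /=.
by case: e; split=> [H|[[]|[]]] //; [right | left].
Qed.

(** The induction hypothesis enters twice: for Z and for the two associated
    subgroups. *)
Lemma re_not_mem_lift (Z : pred (T * int)) : computable Z ->
  re A (fun U => ~ (exists2 h, word_in Z h & eqv hnn_rel U (inl_word h))).
Proof.
move=> CZ; have [_ co] := IH (step_size i0) (step_cyc i0).
apply: (re_not_mem_base sh_assoc shK lev_sh_triv LTZ (listable_unit A)).
- apply: (re_ext (Q := fun W => r0 == W)); last by move=> W; split=> /eqP.
  by apply: re_comp; apply: comp_eq; comp_proj.
- exact: comp_lev_assoc.
- exact: comp_lev_sh.
- exact: re_lev_assoc.
- exact: co.
Qed.

Lemma comp_embed : computable (fun c => embed c).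
Proof.
apply: comp_cat; last exact: comp_w.
apply: comp_if; [by apply: comp_eq; comp_proj | by comp_proj | apply: comp_cons; last by comp_proj].
by apply: comp_pair; [apply: comp_inl|]; comp_proj.
Qed.

Lemma comp_embed_word : computable (fun W : word T => f W).
Proof. by apply: comp_subst; [exact: comp_embed | comp_proj]. Qed.

Lemma comp_strip : computable strip.
Proof.
apply: comp_cat; first exact: comp_embed_word.
apply: comp_winv; apply: (comp_filter (h := fun _ => is_stable)); last exact: comp_embed_word.
apply: (comp_sumcase (f := fun p : word T * ((T * int + unit) * bool) => p.2.1)
  (g := fun=> false) (h := fun=> true)); by comp_proj.
Qed.

Lemma re_not_mem_strip (S : pred T) : computable S -> S b -> ~~ S v ->
  re A (fun W => ~ mem_sub (eq r) S W).
Proof.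
move=> CS Sb Sv; apply: (re_ext (re_app (re_not_mem_lift
  (Z := fun p => S p.1 && (p.1 != b)) _) comp_strip)) => [|W]; last by rewrite mem_sub_strip.
apply: comp_andb; first by apply: (comp1 CS); comp_proj.
by apply: comp_negb; apply: comp_eq; comp_proj.
Qed.

Lemma re_not_mem_level0 (S : pred T) : computable S -> ~~ S b ->
  (forall c, S c -> w c = 0) -> re A (fun W => ~ mem_sub (eq r) S W).
Proof.
move=> CS Sb Sw; apply: (re_ext (re_app (re_not_mem_lift
  (Z := fun p => S p.1 && (p.2 == 0)) _) comp_embed_word)) => [|W]; last by rewrite mem_sub_level0.
apply: comp_andb; first by apply: (comp1 CS); comp_proj.
by apply: comp_eq; comp_proj.
Qed.
End Enumerate.
End Base.

(** If b is the only letter of nonzero weight, then the relator lifts to some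
    letter outside level 0. *)
Lemma level_nonzero i0 : alpha = 1%N -> (forall c, c != b -> w c = 0) ->
  (v, 0) \in map fst (lift_word b w i0 r) ->
  exists c i, (c, i) \in map fst (lift_word b w i0 r) /\ i <> 0.
Proof.
move=> a1 w0 v0; apply: contrapT => nz.
have lev0 p : p \in lift_word b w i0 r -> p.1.2 = 0.
  case: p => [[c i] e] cp /=; apply: contrapT => i_0; apply: nz; exists c, i; split=> //.
  exact: (map_f fst cp).
move: r_v => /mapP[[v' e] + /= vE]; rewrite -{}vE => /splitPr vr.
move: lev0 v0 r_cyc r_w r_b; case: vr => p q lev0 _ cyc rw0 rb.
have wv : w v = 0 by apply: w0.
(* W leads from v to the next occurrence of v in r ++ r. *)
pose W := (v, e) :: q ++ p.
have rrE : (p ++ (v, e) :: q) ++ (p ++ (v, e) :: q) = p ++ rcons W (v, e) ++ q.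
  by rewrite /W -cats1 /= -!catA.
have redW : reduced (rcons W (v, e)).
  by move: cyc; rewrite /cyc_reduced rrE => /cat_sorted2[_ /cat_sorted2[]].
have lev l : l \in lift_word b w (i0 + wsum w p) (rcons W (v, e)) -> l.1.2 = 0.
  move=> lW; apply: lev0; rewrite -[_ \in _]orbb -mem_cat.
  rewrite -[X in _ \in _ ++ lift_word _ _ X _]addr0 -[X in _ \in _ ++ lift_word _ _ (_ + X) _]rw0.
  rewrite -lift_word_cat rrE (lift_word_cat _ _ _ p) (lift_word_cat _ _ _ (rcons W (v, e))).
  by rewrite mem_cat; apply/orP; right; rewrite mem_cat lW.
have lev00 : i0 + wsum w p = 0.
  have := lev ((v, i0 + wsum w p), e); rewrite /= (negbTE v_b) /lift_level /= wv subr0 if_same.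
  by apply; rewrite mem_head.
have [n [s [Z [E bZ]]]] := lift_word_level0 alpha_gt0 w_b w0 a1 (l := (v, e)) v_b redW lev.
rewrite lev00 => n_0; have {}n_0 : n = 0%N by case: (s) n_0; lia.
move: bZ; rewrite -[Z]/([::] ++ Z) -[[::]]/(nseq 0 (b, s)) -n_0 -E.
move: rb => /mapP[l lr lb] /allP /(_ l); rewrite -lb eqxx => H.
suff /H : l \in rcons W (v, e) by [].
move: lr; rewrite /W mem_rcons /= !(mem_cat, inE).
by case/or3P=> ->; rewrite ?orbT.
Qed.

Lemma step_freiheit_special V :
  word_in (predC1 v) V -> eqv (eq r) V [::] -> eqv no_rel V [::].
Proof.
have [i0 [m [M /= [[r00 rm rM rr] mM]]]] := level_data.
exact: (step_free_special r00 rm rM rr mM).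
Qed.

Lemma step_freiheit_stable V : alpha = 1%N -> (forall c, c != b -> w c = 0) ->
  word_in (predC1 b) V -> eqv (eq r) V [::] -> eqv no_rel V [::].
Proof.
move=> a1 w0; have [i0 [m [M /= [[r00 rm rM rr] mM]]]] := level_data.
have [c [i [ci i_0]]] := level_nonzero a1 w0 r00.
by apply: (step_free_level0 (S := predC1 b) r00 rm rM rr mM _ w0 ci i_0); rewrite /= eqxx.
Qed.

Lemma step_co_strip A (S : pred T) : listable A T -> computable A S -> S b -> ~~ S v ->
  re A (fun W => ~ mem_sub (eq r) S W).
Proof.
have [i0 [m [M /= [[r00 rm rM rr] mM]]]] := level_data.
by move=> LT CS Sb Sv; apply: (re_not_mem_strip r00 rm rM rr mM LT).
Qed.

Lemma step_co_level0 A (S : pred T) : listable A T -> computable A S -> ~~ S b ->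
  (forall c, S c -> w c = 0) -> re A (fun W => ~ mem_sub (eq r) S W).
Proof.
have [i0 [m [M /= [[r00 rm rM rr] mM]]]] := level_data.
by move=> LT CS Sb Sw; apply: (re_not_mem_level0 r00 rm rM rr mM LT).
Qed.
End Step.

(** * Relators in one letter *)

Section OneLetter.
Local Open Scope ring_scope.

Lemma eqv_filter (T : eqType) (S : pred T) (r W V : word T) : eqv (eq r) W V ->
  eqv (eq (filter (fun l => S l.1) r)) (filter (fun l => S l.1) W) (filter (fun l => S l.1) V).
Proof.
have filterE U : filter (fun l => S l.1) U = subst (fun c => if S c then [:: (c, false)] else [::]) U.
  by elim: U => //= -[c e] U ->; rewrite subst_cons /lsubst /=; case: (S c); case: e.
by rewrite !filterE; apply: eqv_subst => _ <-; apply: eqv_relator.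
Qed.

(** If the relator has all or none of its letters in S, then erasing the
    letters outside S is a retraction. *)
Lemma retract_mem (T : eqType) (S : pred T) (r W : word T) :
  word_in S r \/ word_in (predC S) r ->
  mem_sub (eq r) S W <-> eqv (eq r) (W ++ winv (filter (fun l => S l.1) W)) [::].
Proof.
move=> Sr; rewrite eqv_divP; split=> [[V SV WV]|WE]; last first.
  by exists (filter (fun l => S l.1) W) => //; apply: filter_all.
have rel : eqv (eq r) (filter (fun l => S l.1) r) [::].
  case: Sr => [/all_filterP ->|]; first exact: eqv_relator.
  move=> nS; suff -> : filter (fun l => S l.1) r = [::] by [].
  by elim: (r) nS => //= l r' IHr /andP[/negbTE -> /IHr].
have := eqv_mono (Rel' := eq r) _ (eqv_filter S WV); rewrite (all_filterP SV).
by move=> -> // _ <-.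
Qed.

Variables (n : nat) (e : bool).

Section Cyclic.
Local Notation rK := (eq (nseq n (tt, e))).

Lemma wsum_nseq k (s : bool) :
  wsum (fun=> 1) (nseq k (tt, s)) = if s then - k%:Z else k%:Z.
Proof. by elim: k => [|k /= ->]; rewrite /lweight /=; case: s; lia. Qed.

(** The exponent sum modulo n is an invariant. *)
Lemma cyclic_wsum W V : eqv rK W V ->
  exists q, wsum (fun=> 1) W - wsum (fun=> 1) V = q * n%:Z.
Proof.
elim=> {W V} [W|W V _ [q E]|W V U _ [q E] _ [q' E']|U V a b|U V _ <-].
- by exists 0; lia.
- by exists (- q); lia.
- by exists (q + q'); lia.
- exists 0; rewrite !wsum_cat /= /lweight /=.
  by move: (wsum _ U) (wsum _ V) => x y; case: b => /=; lia.
exists (if e then - 1 else 1); rewrite !wsum_cat wsum_nseq.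
by move: (wsum _ U) (wsum _ V) => x y; case: e; lia.
Qed.

Lemma cyclic_power W : exists k s, eqv rK W (nseq k (tt, s)).
Proof.
elim: W => [|[[] b] W [k [s WE]]]; first by exists 0%N, false.
case: (eqVneq b s) => [->|bs]; first by exists k.+1, s; rewrite -cat1s WE.
case: k WE => [|k] WE; first by exists 1%N, b; rewrite -cat1s WE.
exists k, s; rewrite -cat1s WE /=.
have -> : s = ~~ b by case: (b) (s) bs => [] [].
rewrite -[X in eqv _ X _]/([:: (tt, b); linv (tt, b)] ++ nseq k (tt, ~~ b)).
by rewrite eqv_linvr.
Qed.

(** The certificate of nontriviality is a power of the generator or of its
    inverse with positive exponent, which is less than n unless n = 0. *)
Lemma cyclic_nontrivial W : ~ eqv rK W [::] <->
  exists (k : nat) s, eqv rK W (nseq k (tt, s)) /\ (0 < k)%N && ((n == 0%N) || (k < n)%N).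
Proof.
split=> [W1|[k [s [WE kn]]] W1]; last first.
  have [q] := cyclic_wsum (eqv_trans (eqv_sym WE) W1); rewrite wsum_nseq subr0.
  case/andP: kn => k0 /orP[/eqP n0|kn].
    by rewrite n0 mulr0; case: (s); lia.
  have [q0|[q0|q0]] : q = 0 \/ q <= - 1 \/ 1 <= q by lia.
  - by rewrite q0 mul0r; case: (s); lia.
  - by case: (s); nia.
  - by case: (s); nia.
have [k0 [s0 WE0]] := cyclic_power W.
elim/ltn_ind: k0 s0 WE0 => k IHk s WE.
case: (boolP ((0 < k)%N && ((n == 0%N) || (k < n)%N))) => [kn|]; first by exists k, s.
rewrite negb_and negb_or -!leqNgt leqn0 => /orP[/eqP k0|/andP[n0 nk]].
  by case: W1; rewrite WE k0.
apply: (IHk (k - n)%N _ s); first by lia.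
rewrite WE -[in X in eqv _ X _](subnKC nk) nseqD.
suff -> : eqv rK (nseq n (tt, s)) [::] by [].
case: (eqVneq s e) => [->|se]; first exact: eqv_relator.
have -> : nseq n (tt, s) = winv (nseq n (tt, e)).
  by rewrite winv_nseq /linv /=; case: s e se {WE} => [] [].
exact: (eqv_winv (eqv_relator (erefl (nseq n (tt, e))))).
Qed.

Lemma re_cyclic_nontrivial A : re A (fun W => ~ eqv rK W [::]).
Proof.
have LU : listable A unit := listable_unit A.
pose P (q : word unit * (nat * bool)) := eqv rK q.1 (nseq q.2.1 (tt, q.2.2)) /\
  (0 < q.2.1)%N && ((n == 0%N) || (q.2.1 < n)%N).
apply: (re_ext (Q := fun W => exists p, P (W, p))); last first.
  move=> W; rewrite cyclic_nontrivial; split=> [[k [s H]]|[[k s] H]].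
    by exists (k, s).
  by exists k, s.
apply: re_ex; first exact: listable_prod (listable_nat A) (listable_bool A).
have reK : re A rK.
  apply: (re_ext (Q := fun W => nseq n (tt, e) == W)); last by move=> W; split=> /eqP.
  by apply: re_comp; apply: comp_eq; comp_proj.
apply: re_and.
  apply: (re_app (re_eqv LU reK) (f := fun q : word unit * (nat * bool) =>
    (q.1, nseq q.2.1 (tt, q.2.2)))).
  apply: comp_pair; first by comp_proj.
  by apply: comp_nseq; comp_proj.
apply: re_comp; apply: comp_andb.
  by apply: comp_leq; comp_proj.
apply: comp_orb; first by comp_proj.
by apply: comp_leq; [apply: comp_succ|]; comp_proj.
Qed.
End Cyclic.

(** The group is the free product of a cyclic group and a free group, an HNN
    extension of the former with trivial associated subgroups. *)
Lemma re_one_letter (T : countType) {cT : Coded T} (t : T) A : listable A T ->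
  re A (fun W : word T => ~ eqv (eq (nseq n (t, e))) W [::]).
Proof.
move=> LT; pose rK := nseq n (tt, e).
pose assoc (_ : T * bool) : pred unit := pred0.
pose sh (_ : T * bool) (y : unit) := y.
pose f (c : T) : word (unit + T) := [:: (if c == t then inl tt else inr c, false)].
pose g (y : unit + T) : word T := [:: (if y is inr c then c else t, false)].
have triv : forall e w, word_in (assoc e) w -> eqv (eq rK) w [::] ->
    eqv (eq rK) (map (fun l => (sh e l.1, l.2)) w) [::].
  by move=> ? [].
have none W : mem_sub (eq rK) pred0 W <-> eqv (eq rK) W [::] by apply: mem_sub_none.
have re0 : re A (fun W => ~ mem_sub (eq rK) pred0 W).
  by apply: (re_ext (re_cyclic_nontrivial A)) => W; rewrite none.
have := re_not_mem_base (assoc := assoc) (sh := sh) (relK := eq rK) _ _ triv (listable_unit A) LT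
  _ _ _ _ re0.
move=> H; apply: (re_ext (re_app (H _ _ _ _ _ _) (f := subst f) _)) => {H} //.
- apply: (re_ext (Q := fun W => rK == W)); last by move=> W; split=> /eqP.
  by apply: re_comp; apply: comp_eq; comp_proj.
- exact: comp_cst.
- by rewrite /sh; comp_proj.
- by apply: (re_app re0); comp_proj.
- apply: comp_subst; last by comp_proj.
  apply: comp_cons; last by comp_proj.
  apply: comp_pair; last by comp_proj.
  apply: comp_if; [by apply: comp_eq; comp_proj | by comp_proj | by apply: comp_inr; comp_proj].
move=> W.
have fE : subst f (nseq n (t, e)) = inl_word T rK.
  by rewrite /rK; elim: (n) => //= k IHk; rewrite subst_cons IHk /lsubst /f /= eqxx; case: e.
have gE : subst g (inl_word T rK) = nseq n (t, e).
  by rewrite /rK; elim: (n) => //= k IHk; rewrite subst_cons IHk /lsubst /g /=; case: e.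
have gf U : subst g (subst f U) = U.
  elim: U => // -[c d] U IHU; rewrite subst_cons subst_cat IHU /lsubst /f /g /=.
  by case: d; case: (eqVneq c t) => [->|].
split=> [W1 [[|//] _ WE]|W1 WE]; last first.
  apply: W1; exists [::] => //; apply: (eqv_subst (v := [::]) _ WE) => _ <-.
  by rewrite fE; apply: eqv_relator; apply: hnn_rel_base.
apply: W1; rewrite -[W]gf; apply: (eqv_subst (v := [::]) _ WE) => _ [_ <-|//].
by rewrite gE; apply: eqv_relator.
Qed.
End OneLetter.

(** * Induction on the length of the relator *)

Section Weights.
Local Open Scope ring_scope.
Variables (T : countType) (cT : Coded T) (b u : T).

Definition weight (x y : int) (c : T) : int :=
  if c == b then x else if c == u then y else 0.

Lemma wsum_weight x y r :
  wsum (weight x y) r = x * wsum (weight 1 0) r + y * wsum (weight 0 1) r.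
Proof.
elim: r => [|[c e] r IHr]; first by rewrite /= !mulr0 addr0.
rewrite [LHS]/= [X in _ = x * X + _]/= [X in _ = _ + y * X]/= IHr !mulrDr.
rewrite addrACA; congr (_ + _); rewrite /lweight /weight /=.
by case: e; case: (c == b); case: (c == u);
  rewrite ?mulrN ?mulr1 ?mulr0 ?oppr0 ?addr0 ?add0r.
Qed.

Lemma comp_weight x y A : computable A (fun c => xpow (weight x y c) : word (T * int + unit)).
Proof.
apply: (comp_ext (g := fun c => if c == b then xpow x else if c == u then xpow y else [::])).
  apply: comp_if; [by apply: comp_eq; comp_proj | by comp_proj |].
  by apply: comp_if; [apply: comp_eq | |]; comp_proj.
by move=> c; rewrite /weight; case: ifP => // _; case: ifP.
Qed.
End Weights.

Section TwoLetters.
Local Open Scope ring_scope.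
Variables (T : countType) (cT : Coded T) (r : word T) (u u' : T).
Hypothesis uu' : u' != u.
Hypothesis r_u : u \in map fst r.
Hypothesis r_u' : u' \in map fst r.
Hypothesis r_cyc : cyc_reduced r.
Hypothesis IH : forall r0 : word (T * int), (size r0 < size r)%N -> cyc_reduced r0 ->
  freiheit r0 /\ co_enumerable r0.

(** If u has exponent sum 0 in the relator, it serves as the stable letter
    itself.  Otherwise u' is given a weight of the size of the exponent sum of
    u, and u the weight that makes the total weight of the relator 0. *)
Lemma two_letters :
  (forall V, word_in (predC1 u) V -> eqv (eq r) V [::] -> eqv no_rel V [::]) /\
  (forall A (S : pred T), listable A T -> computable A S -> ~~ S u ->
     re A (fun W => ~ mem_sub (eq r) S W)).
Proof.
have uu : u != u' by rewrite eq_sym.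
have [s0|s_n0] := eqVneq (wsum (weight u u' 1 0) r) 0.
  have wu : weight u u' 1 0 u = Posz 1 by rewrite /weight eqxx.
  have w0 c : c != u -> weight u u' 1 0 c = 0.
    by rewrite /weight => /negbTE ->; rewrite if_same.
  have cw A := comp_weight cT u u' 1 0 A.
  split=> [V|A S LT CS Su].
    exact: (step_freiheit_stable (alpha := 1) isT wu uu' r_u r_u' r_cyc s0 IH erefl w0).
  apply: (step_co_level0 (alpha := 1) isT wu uu' r_u r_u' r_cyc s0 cw IH LT CS Su) => c Sc.
  by apply: w0; apply: contraNneq Su => <-.
pose s := wsum (weight u' u 0 1) r; pose s' := wsum (weight u' u 1 0) r.
have s_neq0 : s != 0.
  apply/eqP => s_0; case/eqP: s_n0; rewrite -[RHS]s_0 /s; congr (wsum _ r).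
  apply: functional_extensionality_dep => c; rewrite /weight.
  by case: (eqVneq c u) => [->|]; rewrite ?(negbTE uu) ?if_same.
pose alpha := `|s|%N; have alpha_gt0 : (0 < alpha)%N by rewrite /alpha; lia.
pose y := if 0 < s then - s' else s'.
have wu : weight u' u alpha y u' = Posz alpha by rewrite /weight eqxx.
have w_r : wsum (weight u' u alpha y) r = 0.
  rewrite wsum_weight -/s -/s' /alpha /y; case: ifP; nia.
have cw A := comp_weight cT u' u alpha y A.
split=> [V|A S LT CS Su].
  exact: (step_freiheit_special alpha_gt0 wu uu r_u' r_u r_cyc w_r IH).
case: (boolP (S u')) => Su'.
  exact: (step_co_strip alpha_gt0 wu uu r_u' r_u r_cyc w_r cw IH LT CS Su' Su).
apply: (step_co_level0 alpha_gt0 wu uu r_u' r_u r_cyc w_r cw IH LT CS Su') => c Sc.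
rewrite /weight; case: eqP => [cu|_]; first by rewrite -cu Sc in Su'.
by case: eqP => // cu; rewrite -cu Sc in Su.
Qed.
End TwoLetters.

(** The bound n instead of the length itself lets the induction run over all
    types of generators at once: lifting replaces T by T * int. *)
Lemma magnus n : forall (T : countType) (cT : Coded T) (r : word T),
  (size r < n)%N -> cyc_reduced r -> freiheit r /\ co_enumerable r.
Proof.
elim: n => // n IHn T cT r; rewrite ltnS => rn r_cyc.
have IH (r0 : word (T * int)) : (size r0 < size r)%N -> cyc_reduced r0 ->
    freiheit r0 /\ co_enumerable r0.
  by move=> r0r; apply: IHn; apply: leq_trans rn.
(* Either the relator contains a second letter, or it is a power of u. *)
have two u : u \in map fst r -> (exists2 u', u' \in map fst r & u' != u) \/
    word_in (pred1 u) r.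
  move=> ru; case: (boolP (word_in (pred1 u) r)) => [|/allPn[l lr lu]]; [by right | left].
  by exists l.1 => //; apply: map_f.
have retract A (S : pred T) : computable A S -> word_in S r \/ word_in (predC S) r ->
    re A (fun W => ~ eqv (eq r) W [::]) -> re A (fun W => ~ mem_sub (eq r) S W).
  move=> CS Sr re1; apply: (re_ext (re_app re1
    (f := fun W => W ++ winv (filter (fun l => S l.1) W)) _)); last first.
    by move=> W; rewrite (retract_mem W Sr).
  apply: comp_cat; first by comp_proj.
  apply: comp_winv; apply: (comp_filter (h := fun _ l => S l.1)); last by comp_proj.
  by apply: (comp1 CS); comp_proj.
have one u A : word_in (pred1 u) r -> listable A T -> re A (fun W => ~ eqv (eq r) W [::]).
  move=> ru LT; have [e rE] : exists e, r = nseq (size r) (u, e).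
    case: (r) ru r_cyc => [|[c e] r'] /=; first by exists false.
    move=> /andP[/eqP -> {c}]; rewrite /cyc_reduced /reduced /= cat_path => ru /andP[red _].
    exists e; congr cons; elim: r' ru red => //= -[c d] r' IHr /andP[/eqP /= -> ru] /andP[neq red].
    have de : d = e.
      by apply/eqP; apply: contraNT neq => de; rewrite /linv /=; case: (d) (e) de => [] [].
    by move: red; rewrite de => /(IHr ru) <-.
  by rewrite rE; apply: re_one_letter.
split.
  move=> u V ru uV V1; case: (two u ru) => [[u' ru' u'u]|ru1].
    have [free _] := two_letters u'u ru ru' r_cyc IH.
    exact: free.
  have := eqv_filter (predC1 u) V1; rewrite (all_filterP uV) => /(@eqv_mono _ _ no_rel); apply.
  move=> _ <-; suff -> : filter (fun l => predC1 u l.1) r = [::] by [].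
  by elim: (r) ru1 => //= l r' IHr /andP[-> /IHr].
move=> A S LT CS.
have [[u ru Su]|Sr] := pselect (exists2 u, u \in map fst r & ~~ S u).
  case: (two u ru) => [[u' ru' u'u]|ru1].
    have [_ co] := two_letters u'u ru ru' r_cyc IH.
    exact: co.
  apply: (retract A S CS _ (one u A ru1 LT)); right.
  by apply: sub_all ru1 => l /= /eqP ->.
apply: (retract A S CS).
  left; apply/allP => l lr; apply/negPn/negP => nS; apply: Sr.
  by exists l.1 => //; apply: map_f.
have [r0|[u ru]] : r = [::] \/ exists u, u \in map fst r.
- by case: (r) => [|l r']; [left | right; exists l.1; rewrite mem_head].
- by apply: (one (dec 0)) => //; rewrite r0.
case: (two u ru) => [[u' ru' u'u]|ru1]; last exact: (one u).
have [_ co] := two_letters u'u ru ru' r_cyc IH.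
apply: (re_ext (co A pred0 LT (comp_cst _ _) isT)) => W.
by rewrite mem_sub_none.
Qed.

(** A shortest relator with the same consequences is cyclically reduced, since
    two inverse letters that are adjacent or at its ends can be cancelled. *)
Lemma cyc_reduced_relator (T : countType) (r : word T) :
  exists2 r', cyc_reduced r' & forall W V, eqv (eq r) W V <-> eqv (eq r') W V.
Proof.
pose good k := `[< exists2 r' : word T, size r' = k &
  forall W V, eqv (eq r) W V <-> eqv (eq r') W V >].
have ex_good : exists k, good k by exists (size r); apply/asboolP; exists r.
case: (ex_minnP ex_good) => k /asboolP[r' r'k rr'] kmin; exists r' => //.
have shorter m : size m < k ->
    eqv (eq r') m [::] -> eqv (eq m) r' [::] -> False.
  move=> mk m1 r'1; suff : k <= size m by rewrite leqNgt mk.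
  apply: kmin; apply/asboolP; exists m => // W V; rewrite rr'.
  by split; apply: eqv_mono => _ <-.
have pair_free (w : word T) : ~~ reduced w -> exists x l y, w = x ++ l :: linv l :: y.
  elim: w => // l w IHw; rewrite reduced_cons negb_and => /orP[/IHw[x [l' [y ->]]]|].
    by exists (l :: x), l', y.
  by case: w {IHw} => // l' w /negPn /eqP ->; exists [::], l, w.
have pairE (Rel : word T -> Prop) x l y : eqv Rel (x ++ l :: linv l :: y) (x ++ y).
  by case: l => a e; apply: eqv_pair.
apply/negPn/negP => nred.
have red : reduced r'.
  apply/negPn/negP => /pair_free[x [l [y r'E]]].
  apply: (shorter (x ++ y)); first by rewrite -r'k r'E !size_cat /= !addnS; lia.
    by rewrite -(pairE _ x l y) -r'E; apply: eqv_relator.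
  by rewrite r'E pairE; apply: eqv_relator.
case: r' r'k rr' shorter red nred => [|l m] //.
case: (lastP m) => [|m' l'] r'k rr' shorter red.
  rewrite /cyc_reduced /reduced /= andbT => /negPn /eqP.
  by case: (l) => a []; rewrite /linv /= => -[].
rewrite /cyc_reduced /reduced /= cat_path -[path _ l _]/(reduced (l :: rcons m' l')) red /=.
rewrite last_rcons -[path _ l _]/(reduced (l :: rcons m' l')) red andbT => /negPn /eqP lE.
have r'E : l :: rcons m' l' = [:: linv l'] ++ m' ++ [:: l'] by rewrite lE cats1.
have m'k : size m' < k by rewrite -r'k /= size_rcons; lia.
apply: (shorter m' m'k); rewrite r'E; last first.
  by apply: eqv_trans (eqv_ctx [:: linv l'] [:: l'] (eqv_relator (erefl m'))) (eqv_linvl _ l').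
set R := _ ++ _; apply: (@eqv_mulKl _ _ [:: linv l']); apply: (@eqv_mulKr _ _ _ _ [:: l']).
rewrite -catA; apply: eqv_trans (eqv_relator (erefl R)) _.
by symmetry; apply: (eqv_linvl _ l').
Qed.

(** * The decision procedure *)

Lemma comp_search A (X Y : Type) {cX : Coded X} {cY : Coded Y} (Q : X * Y -> bool) :
  listable A X -> listable A Y -> computable A Q -> (forall x, exists y, Q (x, y)) ->
  exists2 F : X -> Y, computable A F & forall x, Q (x, F x).
Proof.
move=> LX LY [q Aq qE] exQ.
have exn n : exists i, Q (dec n, dec i).
  by have [y Qy] := exQ (dec n); exists (enc y); rewrite encK.
pose f n := ex_minn (exn n).
pose p m := 1 - q (cpair (@enc X cX (@dec X cX (csnd m))) (@enc Y cY (@dec Y cY (cfst m)))).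
have pE i n : p (cpair i n) = ~~ Q (dec n, dec i).
  rewrite /p cpairK1 cpairK2; have := qE (dec n, dec i); rewrite /= /enc_pair /= => ->.
  by case: (Q _).
have Ap : rec1 A p.
  apply: rec1_comp (rec1_not A) _; apply: rec1_comp Aq _; apply: rec2_comp (rec2_cpair A) _ _.
    exact: rec1_comp LX (rec1_csnd A).
  exact: rec1_comp LY (rec1_cfst A).
have Af : rec1 A f.
  apply: (rec1_mu Ap) => [n|n i].
    by rewrite pE /f; case: ex_minnP => i ->.
  rewrite pE /f; case: ex_minnP => j _ jmin ij; case: (boolP (Q _)) => // /jmin.
  by rewrite leqNgt ij.
exists (fun x => dec (f (enc x))).
  by exists (fun n => enc (dec (f n) : Y)) => //; apply: rec1_comp LY Af.
move=> x; rewrite /f; case: ex_minnP => i; rewrite encK => Qi _; exact: Qi.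
Qed.

(** An enumerable property whose failure is enumerable as well is decided, with
    a witness, by one search. *)
Lemma comp_decide A (X Y : Type) {cX : Coded X} {cY : Coded Y} (P : X * Y -> Prop) :
  listable A X -> listable A Y -> re A P -> re A (fun x => ~ exists y, P (x, y)) ->
  exists2 F : X -> Y + unit, computable A F &
    forall x, match F x with inl y => P (x, y) | inr _ => ~ exists y, P (x, y) end.
Proof.
move=> LX LY [p Cp pE] [q Cq qE].
pose Q (u : X * (Y * nat + nat)) :=
  match u.2 with inl yn => p ((u.1, yn.1), yn.2) | inr n => q (u.1, n) end.
have CQ : computable A Q.
  apply: (comp_sumcase (f := fun u : X * (Y * nat + nat) => u.2)
    (g := fun v : (X * (Y * nat + nat)) * (Y * nat) => p ((v.1.1, v.2.1), v.2.2))
    (h := fun v : (X * (Y * nat + nat)) * nat => q (v.1.1, v.2))).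
  - by comp_proj.
  - by apply: (comp1 Cp); comp_proj.
  - by apply: (comp1 Cq); comp_proj.
have LZ : listable A (Y * nat + nat).
  by apply: listable_sum (listable_nat A); apply: listable_prod LY (listable_nat A).
have [F CF FQ] : exists2 F, computable A F & forall x, Q (x, F x).
  apply: comp_search LX LZ CQ _ => x; case: (pselect (exists y, P (x, y))) => [[y]|].
    by case/pE=> n pn; exists (inl (y, n)).
  by case/qE=> n qn; exists (inr n).
exists (fun x => match F x with inl yn => inl yn.1 | inr _ => inr tt end).
  apply: (comp_sumcase (g := fun v : X * (Y * nat) => inl v.2.1 : Y + unit)
    (h := fun=> inr tt) CF); last by comp_proj.
  by apply: comp_inl; comp_proj.
move=> x; have := FQ x; rewrite /Q /=; case: (F x) => [[y n]|n] /= Qn.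
  by apply/pE; exists n.
by apply/qE; exists n.
Qed.

(** The numbers of the generators are their indices, so that decoding the number
    of a generator and encoding it again gives the same number. *)
Lemma gen_unpickleK N n (a : gen N) : unpickle n = Some a -> pickle a = n.
Proof.
case: N a => [k|] /= a; last by case.
by rewrite /unpickle /= /pcomp /=; case: insubP => // a' _ <- [<-].
Qed.

(** The algorithm works over the generators nat. The given group is a retract of
    the group with the same relator over all numbers: letters that are not
    generators are erased. *)
Section Transfer.
Variables (N : option nat) (R : word (gen N)) (S : pred (gen N)).
Local Notation G := (gen N).
Local Notation A := (gen_oracle S).

Definition to_nat (a : G) : word nat := [:: (pickle a, false)].
Definition of_nat (n : nat) : word G := if unpickle n is Some a then [:: (a, false)] else [::].

Lemma to_natE W : subst to_nat W = [seq (pickle l.1, l.2) | l : G * bool <- W].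
Proof. by elim: W => //= -[a e] W IHW; rewrite subst_cons IHW; case: e. Qed.

Lemma to_natK W : subst of_nat (subst to_nat W) = W.
Proof.
elim: W => // -[a e] W IHW; rewrite subst_cons subst_cat IHW.
by case: e; rewrite /subst /= /lsubst /of_nat /= pickleK.
Qed.

Lemma to_nat_in W : word_in S W -> word_in A (subst to_nat W).
Proof. by apply: word_in_subst => a Sa; rewrite /word_in /= /gen_oracle pickleK Sa. Qed.

Lemma of_nat_in V : word_in A V -> word_in S (subst of_nat V) /\ subst to_nat (subst of_nat V) = V.
Proof.
elim: V => // -[n e] V IHV /andP[/= An /IHV[SV VE]].
rewrite subst_cons word_in_cat subst_cat SV VE; move: An; rewrite /gen_oracle /lsubst /of_nat /=.
case E : (unpickle n) => [a|] //= Sa; have aE := gen_unpickleK E.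
by case: e; rewrite /word_in /subst /= Sa /lsubst /to_nat /= aE.
Qed.

(** The numbering of letters in [code_word]. *)
Definition letter_code (l : nat * bool) : nat := l.1.*2 + l.2.
Definition code_letter (n : nat) : nat * bool := (n./2, odd n).

Lemma letter_codeK : cancel letter_code code_letter.
Proof.
by case=> n e; rewrite /code_letter /letter_code /= addnC half_bit_double oddD odd_double addbF oddb.
Qed.

Lemma code_wordE (W : word G) : code_word W = enc (map letter_code (subst to_nat W)).
Proof. by rewrite to_natE /= /enc_seq map_id -map_comp. Qed.

Lemma comp_letter_code : computable A (map letter_code : word nat -> seq nat).
Proof.
apply: (comp_map (h := fun _ => letter_code)); last exact: comp_id.
apply: comp_add; first by apply: comp_double; comp_proj.
have Cb : computable A (fun b : bool => (b : nat)) by apply: comp_enc.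
by apply: (comp1 Cb); comp_proj.
Qed.

Lemma comp_code_letter : computable A (map code_letter : seq nat -> word nat).
Proof.
apply: (comp_map (h := fun _ => code_letter)); last exact: comp_id.
by apply: comp_pair; [apply: comp_half | apply: comp_odd]; comp_proj.
Qed.

Lemma comp_oracle : computable A A.
Proof. by exists (fun n => A n) => //; apply: rec1_oracle. Qed.

Lemma solvable_of_nat (F : word nat -> word nat + unit) : computable A F ->
  (forall W, match F W with
             | inl V => word_in A V /\ eqv (eq (subst to_nat R)) W V
             | inr _ => ~ exists V, word_in A V /\ eqv (eq (subst to_nat R)) W V
             end) ->
  extended_identity_problem_solvable R S.
Proof.
move=> CF FP; pose F' W := if F (subst to_nat W) is inl V then Some (subst of_nat V) else None.
exists F'; split; last first.
  move=> W; have := FP (subst to_nat W); rewrite /F'; case: (F _) => [V [AV WV]|_ nV] /=.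
    have [SV VE] := of_nat_in AV; split=> //; apply/eq_modE.
    rewrite -[W]to_natK; apply: (eqv_subst _ WV) => _ <-.
    by rewrite to_natK; apply: eqv_relator.
  move=> V SV /eq_modE WV; apply: nV; exists (subst to_nat V); split; first exact: to_nat_in.
  by apply: (eqv_subst _ WV) => _ <-; apply: eqv_relator.
pose answer (s : seq nat) : nat :=
  match F (map code_letter s) with
  | inl V => (@enc _ (coded_seq coded_nat) (map letter_code V)).+1
  | inr _ => 0
  end.
have [f Af fE] : computable A answer.
  apply: (comp_sumcase (f := fun s => F (map code_letter s))
    (g := fun p : seq nat * word nat => (enc (map letter_code p.2)).+1) (h := fun=> 0)).
  - exact: (comp1 CF comp_code_letter).
  - apply: comp_succ; apply: (comp1 (comp_enc A)); apply: (comp1 comp_letter_code); by comp_proj.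
  - by comp_proj.
exists f; split; first exact: Af.
move=> W; rewrite code_wordE fE /answer /= (mapK letter_codeK).
rewrite /F'; have := FP (subst to_nat W); case: (F _) => [V [AV _]|//] /=.
by rewrite code_wordE (of_nat_in AV).2.
Qed.
End Transfer.

Theorem mainTheorem9 (N : option nat) (R : word (gen N)) (S : pred (gen N)) :
  extended_identity_problem_solvable R S.
Proof.
pose A := gen_oracle S; pose R0 := subst (@to_nat N) R.
have [r r_cyc R0r] := cyc_reduced_relator R0.
have Ln := listable_nat A.
have LW : listable A (word nat) by apply: listable_seq; apply: listable_prod Ln (listable_bool A).
have [_ co] := magnus coded_nat (ltnSn (size r)) r_cyc.
pose P (p : word nat * word nat) := word_in A p.2 /\ eqv (eq R0) p.1 p.2.
have [F CF FP] : exists2 F : word nat -> word nat + unit, computable A F &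
    forall W, match F W with inl V => P (W, V) | inr _ => ~ exists V, P (W, V) end.
  apply: (comp_decide LW LW).
    apply: re_and.
      apply: re_comp; apply: (comp_all (h := fun _ l => A l.1)); last by comp_proj.
      by apply: (comp1 (comp_oracle S)); comp_proj.
    apply: re_eqv => //; apply: (re_ext (Q := fun W => R0 == W)); last by move=> W; split=> /eqP.
    by apply: re_comp; apply: comp_eq; comp_proj.
  apply: (re_ext (co A A Ln (comp_oracle S))) => W.
  split=> nV.
    by case=> V AV /R0r WV; apply: nV; exists V.
  by case=> V [AV /R0r WV]; apply: nV; exists V.
exact: (solvable_of_nat CF FP).
Qed.
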